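(* Let $a\in\mathbb{R}$, $\lambda\ge 0$, $\beta\in(0,1)$ and $p_{01},p_{11}\in(0,1]$, and assume $a^2(1-p_{01})<1$. Consider the POMDP on $\mathbb{R}\times[0,1]$ described in the context, its optimal value function $V^{\beta}$ and the value iterates $V^{\beta}_n$. Then: (a) The value iteration algorithm converges to $V^{\beta}$, i.e. $\lim_{n\to\infty}V^{\beta}_n(e,b)=V^{\beta}(e,b)$ for all $e\in\mathbb{R}$, $b\in[0,1]$. (b) The value function satisfies the optimality equation $$V^{\beta}(e,b)=\min_{u\in\{0,1\}}Q^{\beta}(e,b;u),\qquad e\in\mathbb{R},\ b\in[0,1],$$ where, with $w\sim\mathcal{N}(0,1)$, $$Q^{\beta}(e,b;0)=e^2+\beta\,\mathbb{E}\big[V^{\beta}(ae+w,\mathcal{T}(b))\big],$$ $$Q^{\beta}(e,b;1)=e^2+\lambda+\beta\,\mathbb{E}\big[b\,V^{\beta}(w,p_{11})+(1-b)\,V^{\beta}(ae+w,p_{01})\big].$$ (c) There exists an optimal stationary deterministic policy that, in each state $(e,b)\in\mathbb{R}\times[0,1]$, takes an action attaining the minimum in the right-hand side of the optimality equation in (b).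
   Context: Let $\mathcal{T}(b):=b\,p_{11}+(1-b)\,p_{01}$. Here $p_{01},p_{11}$ are the probabilities that a two-state Markov (Gilbert–Elliott) channel is in the good state $1$ at the next step, given that it is currently in the bad state $0$, respectively the good state $1$. The POMDP: the state at time $t$ is $(e(t),b(t))\in\mathbb{R}\times[0,1]$ (estimation error and belief that the channel is good) and the action is $u(t)\in\{0,1\}$ ($1$ = transmit). From state $(e,b)$ the next state $(e_+,b_+)$ is distributed as follows, with $w\sim\mathcal{N}(0,1)$ independent of the past: - if $u=0$: $(e_+,b_+)=(ae+w,\mathcal{T}(b))$; - if $u=1$: with probability $b$, $(e_+,b_+)=(w,p_{11})$, and with probability $1-b$, $(e_+,b_+)=(ae+w,p_{01})$. A policy $\phi$ chooses, at each time $t$, the action $u(t)$ as a measurable function of the history $\{(e(s),b(s))\}_{s=0}^{t}$ (and past actions). For a policy $\phi$ and initial state $(e(0),b(0))=(e,b)$, $$V^{\beta}(e,b;\phi):=\mathbb{E}_{\phi}\Big(\sum_{t=0}^{\infty}\beta^{t}\big(e(t)^2+\lambda u(t)\big)\Big),\qquad V^{\beta}(e,b):=\min_{\phi}V^{\beta}(e,b;\phi).$$ A policy is optimal if it attains this minimum for every initial state. Value iteration: $V^{\beta}_0\equiv 0$ and, for $n\ge 0$, $V^{\beta}_{n+1}(e,b)=\min_{u\in\{0,1\}}Q^{\beta}_{n+1}(e,b;u)$ with $$Q^{\beta}_{n+1}(e,b;0):=e^2+\beta\,\mathbb{E}\big[V^{\beta}_n(ae+w,\mathcal{T}(b))\big],$$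 $$Q^{\beta}_{n+1}(e,b;1):=e^2+\lambda+\beta\,\mathbb{E}\big[b\,V^{\beta}_n(w,p_{11})+(1-b)\,V^{\beta}_n(ae+w,p_{01})\big].$$ *)

(* Defs.v *)
From HB Require Import structures.
From mathcomp Require Import all_boot all_order all_algebra.
From mathcomp Require Import all_classical all_reals all_analysis.
Set Implicit Arguments.
Unset Strict Implicit.
Unset Printing Implicit Defensive.
Import Order.TTheory GRing.Theory Num.Theory.
Local Open Scope classical_set_scope.
Local Open Scope ring_scope.

(* A state is s = (e, b), with e = s.1 the estimation error and b = s.2 the
   belief. The ambient type of beliefs is R: the state space is the measurable
   subset [st_space], which the dynamics never leave, and every claim is made
   for states in it. An action is a boolean, [true] meaning "transmit". *)
Definition st (R : realType) : Type := (measurableTypeR R * measurableTypeR R)%type.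
HB.instance Definition _ (R : realType) := Measurable.on (st R).

Definition st_space (R : realType) : set (st R) := [set s | 0 <= s.2 <= 1].

(* Infinite state-action trajectories (e(t), b(t), u(t))_t with the product
   sigma-algebra, which is generated by the coordinate maps. *)
Definition cylinders (R : realType) : set (set (nat -> st R * bool)) :=
  \bigcup_t preimage_set_system setT
    (fun om : nat -> st R * bool => om t) measurable.

Definition traj (R : realType) := g_sigma_algebraType (@cylinders R).

Definition past (R : realType) (t : nat) (om : traj R) :
    t.-tuple (st R * bool) :=
  [tuple om i | i < t].

(* At time t a policy sees the states and actions of times 0, ..., t-1 and the
   current state. *)
Definition policy (R : realType) : Type :=
  forall t : nat, {mfun (t.-tuple (st R * bool) * st R)%type >-> bool}.

Definition stationary (R : realType) (phi : policy R)
    (f : {mfun st R >-> bool}) : Prop :=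
  forall t h, phi t h = f h.2.

Section pomdp.
Variables (R : realType) (a lam beta p01 p11 : R).
Implicit Types (s x : st R) (u : bool) (phi : policy R) (V : st R -> \bar R).

Local Notation noise := (normal_prob (0 : R) (1 : R)).

Definition belief_step (b : R) : R := b * p11 + (1 - b) * p01.

Local Open Scope ereal_scope.

(* [trans s u] is the law of the next state from the state s under u. *)
Definition trans s u (A : set (st R)) : \bar R :=
  if u then
    s.2%:E * noise ((fun w => (w, p11)) @^-1` A) +
    (1 - s.2)%:E * noise ((fun w => (a * s.1 + w, p01)%R) @^-1` A)
  else noise ((fun w => (a * s.1 + w, belief_step s.2)%R) @^-1` A).

(* P is the law of the controlled process started from x under phi: the last
   clause says that the conditional law of the state at time t+1, given all the
   states and actions up to time t, is [trans]. *)
Definition is_path_law phi x (P : probability (traj R) R) : Prop :=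
  [/\ P [set om | (om 0%N).1 = x] = 1,
      forall t, P [set om | (om t).2 = phi t (past t om, (om t).1)] = 1 &
      forall t (B : set (t.+1.-tuple (st R * bool))) (A : set (st R)),
        measurable B -> measurable A ->
        P [set om | B (past t.+1 om) /\ A (om t.+1).1] =
        \int[P]_(om in [set om | B (past t.+1 om)])
          trans (om t).1 (om t).2 A].

(* By the Ionescu-Tulcea theorem there is exactly one such law when x is in
   [st_space] and p01, p11 are in [0, 1]; [get] selects it. *)
Definition path_law phi x : probability (traj R) R := get (is_path_law phi x).

Definition total_cost (om : traj R) : \bar R :=
  \sum_(0 <= t <oo)
    (beta ^+ t * ((om t).1.1 ^+ 2 + lam * ((om t).2 : nat)%:R))%:E.

Definition policy_value phi x : \bar R := \int[path_law phi x]_om total_cost om.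

(* The minimum over policies; that it is attained is part of the theorem. *)
Definition opt_value x : \bar R :=
  ereal_inf [set policy_value phi x | phi in [set: policy R]].

Definition optimal phi : Prop :=
  forall x, st_space x -> policy_value phi x = opt_value x.

(* The cost of taking u in the state s and then continuing with cost V. *)
Definition Qfun V s u : \bar R :=
  if u then
    (s.1 ^+ 2 + lam)%:E + beta%:E *
      \int[noise]_w (s.2%:E * V (w, p11) +
                     (1 - s.2)%:E * V (a * s.1 + w, p01)%R)
  else
    (s.1 ^+ 2)%:E + beta%:E * \int[noise]_w V (a * s.1 + w, belief_step s.2)%R.

Definition min_Qfun V s : \bar R := mine (Qfun V s false) (Qfun V s true).

Definition value_iter (n : nat) : st R -> \bar R :=
  iter n min_Qfun (fun=> 0).

End pomdp.

(* Main.v *)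
(* A trajectory is driven by a single uniform variable [w]. The even and the
   odd binary digits of [w] are independent uniform variables, so [w] yields one
   step of the chain (success of the transmission and Gaussian noise) together
   with a fresh uniform variable for the future; iterating this gives the path
   law of every policy without any infinite product measure.

   Since costs are nonnegative, the value iterates increase to some V, and V
   solves the optimality equation by monotone convergence. Under any policy, the
   n-th iterate is at most the expected cost of the first n steps, so V is a
   lower bound for every policy value. Under a policy that is greedy for V, the
   optimality equation telescopes, and the expected cost of the first n steps is
   at most V. Hence V is the optimal value. It is finite because always
   transmitting has a quadratic supersolution when a^2 (1 - p01) < 1. *)
From HB Require Import structures.
Require Import Defs.
From mathcomp Require Import all_boot all_order all_algebra.
From mathcomp Require Import all_classical all_reals all_analysis.
From mathcomp Require Import measurable_realfun.
From mathcomp Require Import ring lra.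
Set Implicit Arguments.
Unset Strict Implicit.
Unset Printing Implicit Defensive.
Import Order.TTheory GRing.Theory Num.Theory.
Import numFieldNormedType.Exports.
Local Open Scope classical_set_scope.
Local Open Scope ring_scope.

(** Two obstacles shape the proof. First, [path_law] is chosen by [get], so nothing is known about
    it until a law satisfying [is_path_law] has been exhibited for every policy. The cost estimates
    then rely only on the clauses of [is_path_law], whichever law is selected. Second, off
    [st_space] the weights in [trans] and [Qfun] can be negative. The dynamics are therefore
    rewritten through a sampler that clamps the belief, which makes nonnegativity, monotonicity and
    measurability global; agreement with the original dynamics holds on [st_space], where every path
    law lives almost surely. The condition on [a] enters as follows: a failed transmission resets
    the belief to [p01], so along consecutive failures the mean square of the inherited error is
    multiplied by [a^2 (1 - p01) < 1] at each step. *)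

Section image_measure.
Context d d' (T : measurableType d) (T' : measurableType d') (R : realType).
Variables (m : {measure set T -> \bar R}) (f : T -> T').
Hypothesis mf : measurable_fun setT f.

Definition image_measure : {measure set T' -> \bar R}.
Proof. by refine (pushforward m f : {measure set T' -> \bar R}). Defined.

Lemma image_measureE A : image_measure A = m (f @^-1` A).
Proof. by []. Qed.

End image_measure.

Lemma measurable_preimageT d d' (T : measurableType d) (T' : measurableType d')
    (f : T -> T') (B : set T') :
  measurable_fun setT f -> measurable B -> measurable (f @^-1` B).
Proof. by move=> mh mB; rewrite -[X in measurable X]setTI; exact: mh. Qed.

Lemma integral_indic_comp d d' (T : measurableType d) (T' : measurableType d')
    (R : realType) (m : {measure set T -> \bar R}) (f : T -> T') (A : set T') :
  measurable_fun setT f -> measurable A ->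
  (\int[m]_x (\1_A (f x))%:E = m (f @^-1` A))%E.
Proof.
move=> mf mA; transitivity (\int[m]_x (\1_(f @^-1` A) x)%:E)%E; first by [].
by rewrite integral_indic// ?setIT//; exact: measurable_preimageT.
Qed.

Lemma integral_prob_cst d (T : measurableType d) (R : realType)
  (P : probability T R)
    (c : \bar R) : (\int[P]_x c = c)%E.
Proof.
rewrite integral_cst// [X in (_ * X)%E](_ : _ = 1%E) ?mule1//.
exact: probability_setT.
Qed.

Lemma measurable_section_measure d d' (T : measurableType d)
  (T' : measurableType d')
    (R : realType) (m : {sigma_finite_measure set T' -> \bar R})
      (Z : set (T * T')) :
  measurable Z -> measurable_fun setT (fun z => m [set v | Z (z, v)]).
Proof.
move=> mZ; apply: eq_measurable_fun (measurable_fun_xsection m mZ) => z _ /=.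
by congr (m _); apply/seteqP; split => v; rewrite /xsection/= inE.
Qed.

Lemma ae_prob1 d (T : measurableType d) (R : realType) (P : probability T R)
    (S Q : set T) : measurable S -> P S = 1%E -> S `<=` Q ->
      {ae P, forall z, Q z}.
Proof.
move=> mS PS SQ; exists (~` S); split; first exact: measurableC.
  by rewrite probability_setC// PS subee.
by move=> z /= nQ /SQ.
Qed.

Lemma le_mine2 d (T : orderType d) (x y x' y' : T) :
  (x <= x')%O -> (y <= y')%O -> (Order.min x y <= Order.min x' y')%O.
Proof. by move=> xx yy; rewrite le_min !ge_min xx yy orbT. Qed.

Lemma mine_le_bool d (T : orderType d) (f : bool -> T) u :
  (Order.min (f false) (f true) <= f u)%O.
Proof. by case: u; rewrite ge_min lexx ?orbT. Qed.

(** * Uniform variables and binary digits *)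

Section measures_on_the_line.
Context {R : realType}.
Local Notation TR := (measurableTypeR R).
Local Notation low_half := (fun x : TR => (x / 2)%R : TR).
Local Notation high_half := (fun x : TR => ((x + 1) / 2)%R : TR).
Implicit Types (s t x : R).

Lemma bigcup_ray : \bigcup_k `]-oo, k%:R]%classic = [set: TR].
Proof.
apply/seteqP; split => // x _; exists (Num.truncn x).+1 => //=.
by rewrite in_itv/= ltW// truncnS_gt.
Qed.

(** Rays are stable under intersection, generate the Borel sets and exhaust the line along the
    integers, so two measures that agree on them agree everywhere once the rays have finite mass. *)
Lemma ray_unique (m1 m2 : {measure set TR -> \bar R}) :
  (m1 setT < +oo)%E -> (forall s, m1 `]-oo, s]%classic = m2 `]-oo,
    s]%classic) ->
  forall A, measurable A -> m1 A = m2 A.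
Proof.
move=> m1T m12 A mA.
have mray s : measurable (`]-oo, s]%classic : set TR) by exact: measurable_itv.
apply: (@measure_unique _ R TR [set B | exists s, B = `]-oo, s]%classic]
  (fun k => `]-oo, k%:R]%classic)) => //.
- have -> : (measurable : set (set TR)) = (@RGenOInfty.G R).-sigma.-measurable.
    exact: RGenOInfty.measurableE.
  rewrite eqEsubset; split => [B|B].
    apply: smallest_sub; first exact: smallest_sigma_algebra.
    move=> _ [s ->]; rewrite -setCitvl; apply: sigma_algebraC.
    by apply: sub_sigma_algebra; exists s.
  apply: smallest_sub; first exact: smallest_sigma_algebra.
  move=> _ [s ->]; rewrite -setCitvr; apply: sigma_algebraC.
  by apply: sub_sigma_algebra; exists s.
- move=> _ _ [s ->] [t ->]; exists (Num.min s t).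
  by apply/seteqP; split => x /=; rewrite !in_itv/= le_min => /andP.
- by move=> i; exists i%:R.
- exact: bigcup_ray.
- by move=> _ [s ->].
- move=> k; apply: le_lt_trans m1T; apply: le_measure => //; rewrite inE//.
Qed.

(** It serves both as the distribution function of the uniform law and as the retraction of the
    reals onto the valid beliefs. *)
Definition clamp x : R := Num.max 0 (Num.min x 1).

Lemma clamp_bounds x : 0 <= clamp x <= 1.
Proof. by rewrite /clamp le_max lexx/= ge_max ler01 ge_min lexx orbT. Qed.

Lemma clamp_id x : 0 <= x <= 1 -> clamp x = x.
Proof. by move=> /andP[x0 x1]; rewrite /clamp min_l// max_r. Qed.

Lemma clamp_le0 x : x <= 0 -> clamp x = 0.
Proof. by move=> x0; rewrite /clamp max_l// ge_min x0. Qed.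

Lemma clamp_ge1 x : 1 <= x -> clamp x = 1.
Proof. by move=> x1; rewrite /clamp min_r// max_r. Qed.

Lemma clamp_double s : clamp (2 * s) + clamp (2 * s - 1) = 2 * clamp s.
Proof.
have [s0|s0] := leP s 0.
  by rewrite !clamp_le0//; lra.
have [s2|s2] := leP s (1/2).
  by rewrite (@clamp_le0 (_ - _)) ?(@clamp_id s) ?(@clamp_id (2 * _)); lra.
have [s1|s1] := leP s 1.
  by rewrite (@clamp_id (_ - _)) ?(@clamp_id s) ?(@clamp_ge1 (2 * _)); lra.
by rewrite !clamp_ge1//; lra.
Qed.

Definition unif : probability TR R := uniform_prob (@ltr01 R).

Arguments unif : simpl never.

Lemma unif_ray s : unif `]-oo, s]%classic = (clamp s)%:E.
Proof.
rewrite /unif/= /uniform_prob integral_uniform_pdf.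
rewrite (eq_integral (fun=> 1%:E)); last first.
  by move=> x; rewrite inE/= !in_itv/= => -[_ x01];
    rewrite /uniform_pdf x01 subr0 invr1.
rewrite integral_cst//=; last exact: measurableI.
rewrite mul1e.
have [s0|s0] := ltP s 0.
  rewrite (_ : _ `&` _ = set0) ?measure0 ?clamp_le0// ?ltW//.
  by apply/seteqP; split => x //=; rewrite !in_itv/=; lra.
have [s1|s1] := leP s 1.
  rewrite (_ : _ `&` _ = `[0, s]%classic).
    rewrite lebesgue_measure_itv/= lte_fin clamp_id ?s0// oppr0 addr0.
    by case: ifPn => // ?; congr EFin; lra.
  by apply/seteqP; split => x /=; rewrite !in_itv/=; lra.
rewrite (_ : _ `&` _ = `[0, 1]%classic).
  by rewrite lebesgue_measure_itv/= lte_fin ltr01 clamp_ge1 ?ltW// oppr0 addr0.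
by apply/seteqP; split => x /=; rewrite !in_itv/=; lra.
Qed.

Lemma measurable_half (c : R) : measurable_fun [set: TR]
  (fun x : TR => ((x + c) / 2 : TR)).
Proof. by apply: measurable_funM => //; exact: measurable_funD. Qed.

(** The leading binary digit of a uniform variable is fair and the remaining digits are again
    uniform. On rays this is [clamp_double]. *)
Lemma unif_self_similar (A : set TR) : measurable A ->
  unif A = ((2^-1)%:E * (unif (low_half @^-1` A) +
                       unif (high_half @^-1` A)))%E.
Proof.
move=> mA.
have m0 : measurable_fun [set: TR] low_half.
  exact: measurable_funM.
have m1 := measurable_half 1.
have h2 : 0 <= 2^-1 :> R by [].
pose m : {measure set TR -> \bar R} := mscale (NngNum h2) (measure_add
  (image_measure unif m0) (image_measure unif m1)).
have mE B : m B = ((2^-1)%:E * (unif (low_half @^-1` B) +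
                       unif (high_half @^-1` B)))%E.
  by rewrite /m /= /mscale /= /measure_add /msum 2!big_ord_recl/= big_ord0
    adde0.
rewrite -mE; apply: ray_unique => [|s|//].
  by rewrite ltey_eq fin_num_measure.
rewrite mE.
  have -> : (fun x : TR => x / 2) @^-1` `]-oo, s]%classic = `]-oo,
    2 * s]%classic.
    by apply/seteqP; split => x /=; rewrite !in_itv/=; lra.
  have -> : (fun x : TR => (x + 1) / 2) @^-1` `]-oo, s]%classic = `]-oo,
    2 * s - 1]%classic.
    by apply/seteqP; split => x /=; rewrite !in_itv/=; lra.
  rewrite !unif_ray -EFinD -EFinM clamp_double mulrA mulVf ?mul1r //.
  exact: unif_ray.
Qed.

End measures_on_the_line.

(** * Splitting the binary digits of a number into two numbers *)

Section splitting.
Context {R : realType}.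
Local Notation TR := (measurableTypeR R).
Implicit Types (s t : R).

(** The supremum of [D] is finite and at most half of itself. [D] will be the distance between a
    distribution function and its expected value. *)
Lemma halving (T : Type) (D : T -> R) : (forall x, D x <= 1) ->
  (forall x, exists y, D x <= D y / 2) -> forall x, D x <= 0.
Proof.
move=> D1 Dh x.
have ubD : has_ubound (range D) by exists 1 => _ [y _ <-].
have h : sup (range D) <= sup (range D) / 2.
  apply: ge_sup; first by exists (D x), x.
  move=> _ [y _ <-]; have [z] := Dh y.
  have : D z <= sup (range D) by apply: ub_le_sup => //; exists z.
  lra.
have : D x <= sup (range D) by apply: ub_le_sup => //; exists x.
lra.
Qed.

Implicit Type x : R.

Definition bit x : R := if 2^-1 <= x then 1 else 0.
(** The doubling map: it deletes the leading digit of a point of [[0, 1[]. *)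
Definition shift x : R := 2 * x - bit x.

Fixpoint even_bits_upto n x : R :=
  if n is m.+1 then (bit x + even_bits_upto m (shift (shift x))) / 2 else 0.

Definition even_bits x : R := limn (even_bits_upto ^~ x).
Definition odd_bits x : R := even_bits (shift x).

Lemma bit01 x : 0 <= bit x <= 1.
Proof. by rewrite /bit; case: ifP => _; rewrite !lexx ler01. Qed.

Lemma even_bits_upto01 n x : 0 <= even_bits_upto n x <= 1.
Proof.
elim: n x => [|n ih] x /=; first by rewrite lexx ler01.
have := ih (shift (shift x)); have := bit01 x; lra.
Qed.

Lemma even_bits_upto_nd x : nondecreasing_seq (even_bits_upto ^~ x).
Proof.
apply/nondecreasing_seqP => n; elim: n x => [|n ih] x.
  by have /andP[] := even_bits_upto01 1 x.
by have := ih (shift (shift x)) => /=; lra.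
Qed.

Lemma cvg_even_bits x : even_bits_upto ^~ x @ \oo --> even_bits x.
Proof.
apply: nondecreasing_is_cvgn; first exact: even_bits_upto_nd.
by exists 1 => _ [n _ <-]; have /andP[] := even_bits_upto01 n x.
Qed.

Lemma even_bits01 x : 0 <= even_bits x <= 1.
Proof.
apply/andP; split.
  apply: limr_ge; first exact: cvg_even_bits.
  by apply: nearW => n; have /andP[] := even_bits_upto01 n x.
apply: limr_le; first exact: cvg_even_bits.
by apply: nearW => n; have /andP[] := even_bits_upto01 n x.
Qed.

(** Stated with [odd_bits] to show the exchange: if [y = shift x], the even digits of [x] are its
    leading digit followed by the odd digits of [y], while the odd digits of [x] are the even digits
    of [y]. *)
Lemma even_bitsE x : even_bits x = (bit x + odd_bits (shift x)) / 2.
Proof.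
have := @cvg_even_bits x; rewrite -cvg_shiftS => h.
apply: (cvg_unique _ h) => //.
by apply: cvgMl; apply: cvgD; [exact: cvg_cst|exact: cvg_even_bits].
Qed.

Lemma measurable_bit : measurable_fun [set: TR] (bit : TR -> TR).
Proof.
apply: measurable_fun_ifT => //; exact: measurable_fun_ler.
Qed.

Lemma measurable_shift : measurable_fun [set: TR] (shift : TR -> TR).
Proof. by apply: measurable_funB;
  [exact: measurable_funM|exact: measurable_bit]. Qed.

Lemma measurable_even_bits : measurable_fun [set: TR] (even_bits : TR -> TR).
Proof.
apply: (measurable_fun_cvg (h := even_bits_upto)); last first.
  by move=> x _; exact: cvg_even_bits.
elim => [|n ih] /=; first exact: measurable_cst.
apply: measurable_funM => //; apply: measurable_funD;
  first exact: measurable_bit.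
apply: (measurableT_comp ih); apply: (measurableT_comp measurable_shift).
exact: measurable_shift.
Qed.

Lemma measurable_odd_bits : measurable_fun [set: TR] (odd_bits : TR -> TR).
Proof. exact: (measurableT_comp measurable_even_bits measurable_shift). Qed.

(** The endpoint 1 is excluded because its half has leading digit 1. Digit identities are thus
    checked on the open unit interval, whose complement is null. *)
Lemma shift_low x : 0 < x < 1 -> bit (x / 2) = 0 /\ shift (x / 2) = x.
Proof.
move=> x01; have b0 : bit (x / 2) = 0 by rewrite /bit; case: ifP => //; lra.
by split=> //; rewrite /shift b0; lra.
Qed.

Lemma shift_high x : 0 < x < 1 -> bit ((x + 1) / 2) = 1 /\
  shift ((x + 1) / 2) = x.
Proof.
move=> x01; have b0 : bit ((x + 1) / 2) = 1 by rewrite /bit; case: ifP => //;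
  lra.
by split=> //; rewrite /shift b0; lra.
Qed.

Lemma unif_off_unit_interval : unif (~` `]0, 1[%classic : set TR) = 0%E.
Proof.
have m1 : measurable ([set 1] : set TR) by exact: measurable_set1.
have u1 : unif ([set 1] : set TR) = 0%E.
  have /null_content_dominatesP := dominates_uniform_prob (@ltr01 R).
  by apply => //; exact: lebesgue_measure_set1.
have u2 : unif (~` `]-oo, 1]%classic : set TR) = 0%E.
  by rewrite probability_setC ?unif_ray ?clamp_id ?ler01 ?lexx// subee.
apply/eqP; rewrite eq_le measure_ge0 andbT.
(* The complement is covered by three null sets: the ray up to 0, the point 1 and what lies above
   1. *)
have -> : 0%E = (unif `]-oo, 0%R]%classic + (unif [set 1%R] + unif (~` `]-oo,
  1%R]%classic)))%E :> \bar R.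
  by rewrite u1 u2 unif_ray clamp_id ?lexx ?ler01// !adde0.
have mC : measurable (~` `]-oo, 1]%classic : set TR) by apply: measurableC.
apply: le_trans (le_trans (measureU2 _ _ _) (leeD2l _ (measureU2 _ _ _))) => //.
- apply: le_measure; rewrite ?inE//; first exact: measurableC.
    by apply: measurableU => //; exact: measurableU.
  move=> x /=; rewrite !in_itv/= => h.
  have [x0|x0] := leP x 0; first by left.
  right; have [x1|x1] := eqVneq x 1; first by left.
  right => x1'; apply: h; rewrite x0 lt_neqAle x1//.
- exact: measurableU.
Qed.

Lemma unif_eq_on_unit_interval (A B : set TR) : measurable A -> measurable B ->
  (forall x, 0 < x < 1 -> A x <-> B x) -> unif A = unif B.
Proof.
move=> mA mB AB.
have red C : measurable C -> unif C = unif (C `&` `]0, 1[%classic : set TR).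
  move=> mC; have mI : measurable (`]0, 1[%classic : set TR) by
    exact: measurable_itv.
  have u0 : unif (C `\` `]0, 1[%classic : set TR) = 0%E.
    apply: (subset_measure0 _ _ _ unif_off_unit_interval).
    - exact: measurableD.
    - exact: measurableC.
    - by move=> x [].
  by rewrite (measureDI unif mC mI) [X in (X + _)%E]u0 add0e.
rewrite red// [RHS]red//; congr (unif _).
by apply/seteqP; split=> x /= [Cx]; rewrite in_itv/= => /[dup] x01 /AB[]; tauto.
Qed.

End splitting.

(** * Joint law of the even and the odd digits *)

Section splitting_law.
Context {R : realType}.
Local Notation TR := (measurableTypeR R).
Local Notation low_half := (fun x : TR => (x / 2)%R : TR).
Local Notation high_half := (fun x : TR => ((x + 1) / 2)%R : TR).
Implicit Types (s t : R).

Let mf : measurable_fun [set: TR] (even_bits : TR -> TR) :=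
  measurable_even_bits.
Let mg : measurable_fun [set: TR] (odd_bits : TR -> TR) := measurable_odd_bits.

Definition bits_law (A B : set TR) : R :=
  fine (unif (even_bits @^-1` A `&` odd_bits @^-1` B)).

(* Prepending a binary digit exchanges the even and the odd digits, so their
   joint law is a fixed point of the map below. Its distance to the law of two
   independent uniform variables is at most half of itself, hence zero. *)
Lemma bits_law_step (A B : set TR) : measurable A -> measurable B ->
  bits_law A B =
  (bits_law B (low_half @^-1` A) +
   bits_law B (high_half @^-1` A)) / 2.
Proof.
move=> mA mB; rewrite /bits_law.
have mh0 : measurable_fun [set: TR] low_half.
  exact: measurable_funM.
have mh1 := @measurable_half R 1.
have mAB : measurable (even_bits @^-1` A `&` odd_bits @^-1` B : set TR).
  by apply: measurableI; exact: measurable_preimageT.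
rewrite (unif_self_similar mAB).
(* The point [x / 2] has leading digit 0, so its even digits give [odd_bits x / 2] and its odd
   digits give [even_bits x]; hence [A] and [B] trade places. *)
have -> : unif (low_half @^-1` (even_bits @^-1` A `&` odd_bits @^-1` B))
  = unif (even_bits @^-1` B `&` odd_bits @^-1` (low_half @^-1` A)).
  apply: unif_eq_on_unit_interval.
  - exact: measurable_preimageT.
  - by apply: measurableI; apply: measurable_preimageT => //;
      exact: measurable_preimageT.
  - move=> x /shift_low[b0 sx] /=; rewrite even_bitsE b0 sx add0r /odd_bits sx;
      tauto.
have -> : unif (high_half @^-1` (even_bits @^-1` A `&` odd_bits @^-1` B))
  = unif (even_bits @^-1` B `&` odd_bits @^-1` (high_half @^-1` A)).
  apply: unif_eq_on_unit_interval.
  - exact: measurable_preimageT.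
  - by apply: measurableI; apply: measurable_preimageT => //;
      exact: measurable_preimageT.
  - by move=> x /shift_high[b0 sx] /=; rewrite even_bitsE b0 sx
      (addrC 1) /odd_bits sx; tauto.
have mI (h : TR -> TR) : measurable_fun setT h ->
    measurable (even_bits @^-1` B `&` odd_bits @^-1` (h @^-1` A) : set TR).
  by move=> mh; apply: measurableI; apply: measurable_preimageT => //;
    exact: measurable_preimageT.
have fin (h : TR -> TR) : measurable_fun setT h ->
    unif (even_bits @^-1` B `&` odd_bits @^-1` (h @^-1` A)) \is a fin_num.
  by move=> mh; rewrite fin_num_measure//; exact: mI.
have half_fine (x y : \bar R) : x \is a fin_num -> y \is a fin_num ->
    fine ((2^-1)%:E * (x + y))%E = (fine x + fine y) / 2.
  by move: x y => [x| |] [y| |]//= _ _; rewrite mulrC.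
by rewrite half_fine//; exact: fin.
Qed.

Lemma bits_law_bounds A B : measurable A -> measurable B ->
  0 <= bits_law A B <= 1.
Proof.
move=> mA mB; rewrite /bits_law fine_ge0 ?measure_ge0//=.
have mI : measurable (even_bits @^-1` A `&` odd_bits @^-1` B : set TR).
  by apply: measurableI; exact: measurable_preimageT.
by rewrite -lee_fin fineK ?fin_num_measure// probability_le1.
Qed.

Let ray t : set TR := `]-oo, t]%classic.
Let mray t : measurable (ray t).
Proof. exact: measurable_itv. Qed.

Let half_ray t : low_half @^-1` (ray t) = ray (2 * t).
Proof. by apply/seteqP; split => x; rewrite /ray /= !in_itv/=; lra. Qed.

Let half_ray1 t : high_half @^-1` (ray t) = ray (2 * t - 1).
Proof. by apply/seteqP; split => x; rewrite /ray /= !in_itv/=; lra. Qed.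

Let law0 (A : set TR) t : t < 0 -> bits_law A (ray t) = 0 /\
  bits_law (ray t) A = 0.
Proof.
move=> t0; have h (f : TR -> TR) : (forall x, 0 <= f x) ->
  f @^-1` (ray t) = set0.
  by move=> f0; apply/seteqP; split => x; rewrite /ray /= ?in_itv/= => ft //;
    have := f0 x; lra.
rewrite /bits_law !h ?setI0 ?set0I ?measure0//.
- by move=> x; have /andP[] := even_bits01 x.
- by move=> x; have /andP[] := even_bits01 (shift x).
Qed.

Let law1 t : 1 <= t ->
  even_bits @^-1` (ray t) = setT /\ odd_bits @^-1` (ray t) = setT.
Proof.
move=> t1; split; apply/seteqP; split=> x // _; rewrite /ray /= in_itv/=.
- by have /andP[_] := even_bits01 x; lra.
- by have /andP[_] := even_bits01 (shift x); rewrite /odd_bits; lra.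
Qed.

Lemma odd_bits_law B : measurable B -> bits_law setT B = bits_law B setT.
Proof.
move=> mB; rewrite bits_law_step// !preimage_setT; lra.
Qed.

Lemma even_bits_ray t : bits_law (ray t) setT = clamp t.
Proof.
apply/eqP; rewrite -subr_eq0 -normr_le0; apply/(@halving R R (fun t =>
   `|bits_law (ray t) setT - clamp t|)) => {t} t.
  have := bits_law_bounds (mray t) measurableT; have := clamp_bounds t.
  by rewrite ler_norml; lra.
rewrite bits_law_step// half_ray half_ray1 !odd_bits_law//.
have cd := clamp_double t.
(* One of the two pulled-back rays is always trivial: below 1/2 the ray up to [2 t - 1] has mass 0,
   from 1/2 on the ray up to [2 t] has mass 1. The distance at [t] is then half the distance at the
   other endpoint, which is the witness. *)
have [t2|t2] := ltP t (1/2).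
  have tn : 2 * t - 1 < 0 by lra.
  exists (2 * t); have [_ ->] := law0 setT tn.
  rewrite -[X in _ <= _ / X](@gtr0_norm _ 2)// -normf_div.
  by move: cd; rewrite (@clamp_le0 _ (2 * t - 1));
    [move=> cd; rewrite le_eqVlt; apply/orP; left; apply/eqP; congr `|_|;
      lra|lra].
exists (2 * t - 1).
have -> : bits_law (ray (2 * t)) setT = 1.
  have [|h _] := @law1 (2 * t); first lra.
  by rewrite /bits_law h preimage_setT setIT probability_setT.
rewrite -[X in _ <= _ / X](@gtr0_norm _ 2)// -normf_div.
move: cd; rewrite (@clamp_ge1 _ (2 * t)); last lra.
by move=> cd; rewrite le_eqVlt; apply/orP; left; apply/eqP; congr `|_|; lra.
Qed.

Lemma bits_ray s t : bits_law (ray s) (ray t) = clamp s * clamp t.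
Proof.
apply/eqP; rewrite -subr_eq0 -normr_le0; apply/(@halving R (R * R) (fun p =>
   `|bits_law (ray p.1) (ray p.2) - clamp p.1 * clamp p.2|)
   _ _ (s, t)) => {s t} -[s t]/=.
  have := bits_law_bounds (mray s) (mray t); have := clamp_bounds s; have :=
    clamp_bounds t.
  by rewrite ler_norml; nra.
rewrite bits_law_step// half_ray half_ray1.
have cd := clamp_double s.
(* Same dichotomy on [s], with the coordinates of the witness swapped by the exchange of digits.
   When the ray up to [2 s] has full mass, its term is the marginal law given by [even_bits_ray]. *)
have [s2|s2] := ltP s (1/2).
  have tn : 2 * s - 1 < 0 by lra.
  exists (t, 2 * s) => /=; have [-> _] := law0 (ray t) tn.
  rewrite -[X in _ <= _ / X](@gtr0_norm _ 2)// -normf_div.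
  move: cd; rewrite (@clamp_le0 _ (2 * s - 1)); last lra.
  by move=> cd; rewrite le_eqVlt; apply/orP; left; apply/eqP; congr `|_|; nra.
exists (t, 2 * s - 1) => /=.
have -> : bits_law (ray t) (ray (2 * s)) = clamp t.
  have [|_ h] := @law1 (2 * s); first lra.
  by rewrite -even_bits_ray /bits_law h preimage_setT.
rewrite -[X in _ <= _ / X](@gtr0_norm _ 2)// -normf_div.
move: cd; rewrite (@clamp_ge1 _ (2 * s)); last lra.
by move=> cd; rewrite le_eqVlt; apply/orP; left; apply/eqP; congr `|_|; nra.
Qed.

End splitting_law.

Section splitting_integral.
Context {R : realType}.
Local Notation TR := (measurableTypeR R).

Let mf : measurable_fun [set: TR] (even_bits : TR -> TR) :=
  measurable_even_bits.
Let mg : measurable_fun [set: TR] (odd_bits : TR -> TR) := measurable_odd_bits.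

Let fin_bits (A B : set TR) : measurable A -> measurable B ->
  unif (even_bits @^-1` A `&` odd_bits @^-1` B) = (bits_law A B)%:E.
Proof.
move=> mA mB; rewrite fineK// fin_num_measure//.
by apply: measurableI; exact: measurable_preimageT.
Qed.

(** Two uses of [ray_unique]: first in [A] with a ray for [B], then in [B] with [A] arbitrary. Each
    time both sides are finite measures in the set that varies. *)
Lemma unif_bits (A B : set TR) : measurable A -> measurable B ->
  unif (even_bits @^-1` A `&` odd_bits @^-1` B) = (unif A * unif B)%E.
Proof.
move=> mA mB.
have mray t : measurable (`]-oo, t]%classic : set TR) by exact: measurable_itv.
have mgB t := measurable_preimageT mg (mray t).
have mfA := measurable_preimageT mf mA.
have c0 t : 0 <= clamp t :> R by have /andP[] := clamp_bounds t.
have step t : unif (even_bits @^-1` A `&` odd_bits @^-1` `]-oo, t]%classic) =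
    (unif A * (clamp t)%:E)%E.
  pose m1 := image_measure (mrestr unif (mgB t)) mf.
  pose m2 : {measure set TR -> \bar R} := mscale (NngNum (c0 t)) unif.
  have m1E C : m1 C = unif (even_bits @^-1` C `&` odd_bits @^-1` `]-oo,
    t]%classic).
    by [].
  have m2E C : m2 C = ((clamp t)%:E * unif C)%E by [].
  rewrite muleC -m1E -m2E; apply: ray_unique => //.
  - by rewrite m1E fin_bits// ltry.
  - by move=> s; rewrite m1E m2E fin_bits// bits_ray unif_ray mulrC.
have a0 : 0 <= fine (unif A) by rewrite fine_ge0.
pose m1 := image_measure (mrestr unif mfA) mg.
pose m2 : {measure set TR -> \bar R} := mscale (NngNum a0) unif.
have m1E C : m1 C = unif (even_bits @^-1` A `&` odd_bits @^-1` C) by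
  rewrite setIC.
have m2E C : m2 C = (unif A * unif C)%E.
  by rewrite /m2 /= /mscale /= fineK// fin_num_measure.
rewrite -m1E -m2E; apply: ray_unique => //.
- by rewrite m1E fin_bits// ltry.
- by move=> s; rewrite m1E m2E step unif_ray.
Qed.

Local Open Scope ereal_scope.

Lemma integral_bits (h : TR * TR -> \bar R) : measurable_fun setT h ->
  (forall z, 0 <= h z) ->
  \int[unif]_v h (even_bits v, odd_bits v) = \int[unif]_x \int[unif]_y h (x, y).
Proof.
move=> mh h0.
have mfg : measurable_fun [set: TR] (fun v : TR => (even_bits v, odd_bits v) :
  TR * TR).
  exact: measurable_fun_pair.
rewrite -(fubini_tonelli1 (m1 := unif) (m2 := unif) h)//.
rewrite (eq_measure_integral (image_measure unif mfg)).
  by rewrite ge0_integral_pushforward// preimage_setT.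
move=> A mA _; apply: product_measure_unique => // B C mB mC.
rewrite -unif_bits//.
Qed.

Lemma integral_even_bits (h : TR -> \bar R) : measurable_fun setT h ->
  (forall z, 0 <= h z) ->
  \int[unif]_v h (even_bits v) = \int[unif]_v h v.
Proof.
move=> mh h0; have mhf : measurable_fun [set: TR * TR] (h \o fst).
  exact: (measurableT_comp mh measurable_fst).
rewrite (integral_bits mhf); last by move=> z; exact: h0.
by apply: eq_integral => x _; exact: (integral_prob_cst unif (h x)).
Qed.

Lemma integral_odd_bits (h : TR -> \bar R) : measurable_fun setT h ->
  (forall z, 0 <= h z) ->
  \int[unif]_v h (odd_bits v) = \int[unif]_v h v.
Proof.
move=> mh h0; have mhs : measurable_fun [set: TR * TR] (h \o snd).
  exact: (measurableT_comp mh measurable_snd).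
rewrite (integral_bits mhs); last by move=> z; exact: h0.
exact: (integral_prob_cst unif (\int[unif]_v h v)).
Qed.

End splitting_integral.

(** * Inverse transform sampling *)

Section inverse_transform_sampling.
Context {R : realType}.
Local Notation TR := (measurableTypeR R).
Variable P : probability TR R.

(** The identity is a random variable of law [P], so the known limits and right continuity of its
    distribution function apply to [F]. *)
Let idTR : TR -> R := idfun.

#[local] HB.instance Definition _ :=
  @isMeasurableFun.Build _ _ _ _ idTR (@measurable_id _ _ setT).

Let F (x : R) : R := fine (P `]-oo, x]%classic).

Let mray (t : R) : measurable (`]-oo, t]%classic : set TR).
Proof. exact: measurable_itv. Qed.

Let FE (x : R) : (F x)%:E = P `]-oo, x]%classic.
Proof. by rewrite fineK// fin_num_measure. Qed.

Let F_nd : nondecreasing_fun F.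
Proof.
move=> x y xy; rewrite -lee_fin !FE; apply: le_measure; rewrite ?inE//.
exact: subset_itvl.
Qed.

Definition quantile0 (u : R) : R := inf [set x | u <= F x].
(* Set to 0 outside ]0, 1[, where the infimum can be a junk value. *)
Definition quantile : R -> R := quantile0 \_ `]0, 1[%classic.

(** The limits of [F] at both infinities make the set under the infimum nonempty and bounded below,
    and right continuity puts the infimum itself in the set; monotonicity does the rest. *)
Lemma quantile0P (u x : R) : 0 < u < 1 -> (quantile0 u <= x) = (u <= F x).
Proof.
move=> /andP[u0 u1].
have F1 : F @ +oo --> (1 : R).
  by apply: fine_cvg; exact: (@cvg_cdfy1 _ _ _ P idTR).
have F0 : F @ -oo --> (0 : R).
  by apply: fine_cvg; exact: (@cvg_cdfNy0 _ _ _ P idTR).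
have [y Fy] : exists y, u <= F y.
  have [y Fy] := filter_ex (cvgr_gt (FF := _) _ F1 _ u1); exists y; exact: ltW.
have [z Fz] : exists z, F z < u.
  have [z Fz] := filter_ex (cvgr_lt (FF := _) _ F0 _ u0); by exists z.
have hl : has_lbound [set x | u <= F x].
  exists z => t /= ut; rewrite leNgt; apply/negP => tz.
  have := F_nd (ltW tz); lra.
have hi : has_inf [set x | u <= F x] by split=> //; exists y.
apply/idP/idP => [qx|ux]; last exact: ge_inf.
have Fright t : quantile0 u < t -> u <= F t.
  move=> /(inf_lt hi.1)[s /= us st]; apply: le_trans us _; exact: F_nd (ltW st).
have : u <= F (quantile0 u).
  have rc : F t @[t --> (quantile0 u)^'+] --> F (quantile0 u).
    apply: fine_cvg; rewrite FE; exact: (@cdf_right_continuous _ _ _ P idTR).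
  rewrite -(cvg_lim _ rc)//; apply: limr_ge; first by apply/cvg_ex;
    exists (F (quantile0 u)).
  near=> t; apply: Fright; near: t; exact: nbhs_right_gt.
move=> h; apply: le_trans h _; exact: F_nd.
Unshelve. all: by end_near. Qed.

Lemma measurable_quantile : measurable_fun [set: TR] (quantile : TR -> TR).
Proof.
have m01 : measurable (`]0, 1[%classic : set TR) by exact: measurable_itv.
apply/(measurable_restrictT _ m01).
apply: (measurability (@RGenOInfty.G R)) => [|_ [_ [x ->] <-]].
  exact: RGenOInfty.measurableE.
have -> : `]0, 1[%classic `&` quantile0 @^-1` `]x, +oo[%classic =
    `]0, 1[%classic `&` `]F x, +oo[%classic.
  apply/seteqP; split => u /=; rewrite !in_itv/= !andbT => -[u01];
    by rewrite [x < _]ltNge quantile0P// -ltNge.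
by apply: measurableI => //; exact: measurable_itv.
Qed.

Lemma unif_quantile (A : set TR) : measurable A -> unif (quantile @^-1` A) =
  P A.
Proof.
move=> mA.
rewrite -(image_measureE unif measurable_quantile); apply: ray_unique => //.
  by rewrite image_measureE preimage_setT ltey_eq fin_num_measure.
move=> s; rewrite image_measureE.
have Fs01 : 0 <= F s <= 1.
  by rewrite -!lee_fin FE measure_ge0 probability_le1.
transitivity (unif `]-oo, F s]%classic); last by rewrite unif_ray clamp_id// FE.
apply: unif_eq_on_unit_interval.
- exact: measurable_preimageT measurable_quantile _.
- exact: measurable_itv.
- move=> u u01; rewrite /= !in_itv/= /quantile patchE mem_set/= ?in_itv//=.
  by rewrite quantile0P.
Qed.

Local Open Scope ereal_scope.
Lemma integral_quantile (h : TR -> \bar R) : measurable_fun setT h ->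
  (forall z, 0 <= h z) ->
  \int[unif]_v h (quantile v) = \int[P]_w h w.
Proof.
move=> mh h0; rewrite [RHS](eq_measure_integral
  (image_measure unif measurable_quantile)).
  by rewrite ge0_integral_pushforward//; exact: measurable_quantile.
by move=> A mA _; rewrite image_measureE; apply/esym/unif_quantile.
Qed.

End inverse_transform_sampling.

(** * The transition law *)

Definition noise (R : realType) : probability (measurableTypeR R) R :=
  normal_prob (0 : R) (1 : R).
Arguments noise : simpl never.

Section sampling.
Variables (R : realType) (a p01 p11 : R).
Local Notation noise := (noise R).
Local Notation TR := (measurableTypeR R).
Implicit Types (s : st R) (u : bool).

(* A draw from the transition law driven by one uniform variable [v]: its even
   bits decide whether the transmission succeeds, its odd bits give the noise.
   Clamping the belief makes this a kernel on the whole ambient type. *)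
Definition sample s u (v : TR) : st R :=
  if u then
    if even_bits v <= clamp s.2 then (quantile noise (odd_bits v), p11)
    else (a * s.1 + quantile noise (odd_bits v), p01)
  else (a * s.1 + quantile noise (odd_bits v), belief_step p01 p11 (clamp s.2)).

Lemma measurable_clamp : measurable_fun [set: TR] (clamp : TR -> TR).
Proof.
by apply: measurable_maxr => //; exact: measurable_minr.
Qed.

Lemma measurable_sample :
  measurable_fun [set: st R * bool * TR] (fun z => sample z.1.1 z.1.2 z.2).
Proof.
have mv : measurable_fun [set: st R * bool * TR] (fun z => z.2) by
  exact: measurable_snd.
have mu : measurable_fun [set: st R * bool * TR] (fun z => z.1.2).
  exact: measurableT_comp measurable_snd measurable_fst.
have ms : measurable_fun [set: st R * bool * TR] (fun z => z.1.1).
  exact: measurableT_comp measurable_fst measurable_fst.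
have me : measurable_fun [set: st R * bool * TR] (fun z => z.1.1.1 : TR).
  exact: measurableT_comp measurable_fst ms.
have mb : measurable_fun [set: st R * bool * TR] (fun z => clamp z.1.1.2 : TR).
  apply: (measurableT_comp measurable_clamp).
  exact: measurableT_comp measurable_snd ms.
have mw : measurable_fun [set: st R * bool * TR]
  (fun z => quantile noise (odd_bits z.2) : TR).
  apply: (measurableT_comp (measurable_quantile noise)).
  exact: measurableT_comp measurable_odd_bits mv.
have maw : measurable_fun [set: st R * bool * TR]
    (fun z => a * z.1.1.1 + quantile noise (odd_bits z.2) : TR).
  by apply: measurable_funD => //; exact: measurable_funM.
apply: measurable_fun_ifT => //.
- apply: measurable_fun_ifT.
  + apply: measurable_fun_ler => //;
      exact: measurableT_comp measurable_even_bits mv.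
  + exact: measurable_fun_pair.
  + exact: measurable_fun_pair.
- apply: measurable_fun_pair => //; rewrite /belief_step.
  by apply: measurable_funD; apply: measurable_funM => //;
    exact: measurable_funB.
Qed.

Lemma measurable_sample_at s u : measurable_fun [set: TR] (sample s u).
Proof.
exact: (measurableT_comp measurable_sample (pair1_measurable (s, u))).
Qed.

Lemma sample_st_space s u v : 0 <= p01 <= 1 -> 0 <= p11 <= 1 ->
  st_space (sample s u v).
Proof.
move=> h0 h1; rewrite /st_space/= /sample; case: u; first by case: ifP.
by have := clamp_bounds s.2; rewrite /belief_step/=; nra.
Qed.

Local Open Scope ereal_scope.

Lemma integral_threshold (b : R) (x y : \bar R) : (0 <= b <= 1)%R -> 0 <= x ->
  0 <= y ->
  \int[unif]_v (if (v <= b)%R then x else y) = b%:E * x + (1 - b)%:E * y.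
Proof.
move=> b01 x0 y0.
have mr : measurable (`]-oo, b]%classic : set TR) by exact: measurable_itv.
have mh : measurable_fun [set: TR] (fun v : TR => if (v <= b)%R then x else y).
  by apply: measurable_fun_ifT => //; exact: measurable_fun_ler.
rewrite -(setUv (`]-oo, b]%classic : set TR)) ge0_integral_setU//; first last.
- by apply/disj_setPCl.
- by move=> v _; case: ifP.
- by rewrite setUv.
- exact: measurableC.
rewrite (eq_integral (cst x)); last by move=> v; rewrite inE/= in_itv/= => ->.
rewrite [X in _ + X](eq_integral (cst y)); last first.
  by move=> v; rewrite inE/= in_itv/= => /negP/negbTE ->.
rewrite !integral_cst//; last exact: measurableC.
have uC : unif (~` `]-oo, b]%classic : set TR) = (1 - b)%:E.
  by rewrite probability_setC// unif_ray clamp_id.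
have uB : unif (`]-oo, b]%classic : set TR) = b%:E by rewrite unif_ray clamp_id.
by rewrite muleC [X in _ + X]muleC; congr (_ * _ + _ * _);
  [exact: uB|exact: uC].
Qed.

Definition next_mean (g : st R -> \bar R) s u := \int[unif]_v g (sample s u v).

Section kop.
Variable g : st R -> \bar R.
Hypotheses (mg : measurable_fun setT g) (g0 : forall s, 0 <= g s).

Lemma next_meanE s u : st_space s -> next_mean g s u =
  if u then s.2%:E * (\int[noise]_w g (w, p11)) +
            (1 - s.2)%:E * (\int[noise]_w g (a * s.1 + w, p01)%R)
  else \int[noise]_w g (a * s.1 + w, belief_step p01 p11 s.2)%R.
Proof.
move=> /= b01; rewrite /next_mean /sample clamp_id//.
have mq := measurable_quantile noise.
have mg1 : measurable_fun [set: TR] (fun w : TR => g (w, p11)).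
  by apply: (measurableT_comp mg); exact: measurable_fun_pair.
have mg2 c : measurable_fun [set: TR] (fun w : TR => g (a * s.1 + w, c)%R).
  apply: (measurableT_comp mg); apply: measurable_fun_pair => //.
  exact: measurable_funD.
case: u.
- pose h (z : TR * TR) := if (z.1 <= s.2)%R then g (quantile noise z.2, p11)
    else g (a * s.1 + quantile noise z.2, p01)%R.
  have mh : measurable_fun [set: TR * TR] h.
    apply: measurable_fun_ifT.
    + by apply: measurable_fun_ler => //; exact: measurable_fst.
    + exact: (measurableT_comp mg1 (measurableT_comp mq measurable_snd)).
    + exact: (measurableT_comp (mg2 _) (measurableT_comp mq measurable_snd)).
  have h0 z : 0 <= h z by rewrite /h; case: ifP.
  transitivity (\int[unif]_v h (even_bits v, odd_bits v)).
    by apply: eq_integral => v _; rewrite /h/=; case: ifP.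
  (* With the two digit families independent, the even one only selects the branch, with probability
     [s.2], and the odd one becomes the Gaussian noise. *)
  rewrite integral_bits// -integral_threshold//; last 2 first.
    by apply: integral_ge0.
    by apply: integral_ge0.
  apply: eq_integral => x _; rewrite /h/=; case: ifP => _.
    by rewrite -(integral_quantile noise mg1).
  by rewrite -(integral_quantile noise (mg2 _)).
- pose h (y : TR) := g (a * s.1 + quantile noise y, belief_step p01 p11 s.2)%R.
  have mh : measurable_fun [set: TR] h by exact: (measurableT_comp (mg2 _) mq).
  have h0 z : 0 <= h z by exact: g0.
  by rewrite -(integral_quantile noise (mg2 _))// -(integral_odd_bits mh h0).
Qed.
End kop.

End sampling.

(** * The optimality equation *)

Section optimality_operator.
Variables (R : realType) (a lam beta p01 p11 : R).
Hypotheses (hlam : 0 <= lam) (hbeta : 0 < beta < 1)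
  (hp01 : 0 <= p01 <= 1) (hp11 : 0 <= p11 <= 1).
Local Notation TR := (measurableTypeR R).
Implicit Types (s : st R) (u : bool) (V : st R -> \bar R).
Local Notation next_mean := (next_mean a p01 p11).
Local Notation sample := (sample a p01 p11).

Local Open Scope ereal_scope.

Lemma transE s u (A : set (st R)) : st_space s -> measurable A ->
  trans a p01 p11 s u A = unif (sample s u @^-1` A).
Proof.
move=> ss mA.
pose g x : \bar R := (\1_A x)%:E.
have mg : measurable_fun [set: st R] g by apply/measurable_EFinP;
  exact: measurable_indic.
have g0 x : 0 <= g x by rewrite /g lee_fin indicE.
rewrite -(integral_indic_comp unif (@measurable_sample_at _ a p01 p11 s u) mA).
rewrite -[RHS]/(next_mean g s u) next_meanE// /trans.
have ma c : measurable_fun [set: TR] (fun w : TR => (a * s.1 + w, c)%R : st R).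
  by apply: measurable_fun_pair => //; exact: measurable_funD.
have mw : measurable_fun [set: TR] (fun w : TR => (w, p11) : st R).
  exact: measurable_fun_pair.
by case: u; rewrite ?(integral_indic_comp (noise R) mw mA)
  (integral_indic_comp (noise R) (ma _) mA).
Qed.

Lemma measurable_next_mean V : measurable_fun setT V -> (forall s, 0 <= V s) ->
  measurable_fun [set: st R * bool] (fun z => next_mean V z.1 z.2).
Proof.
move=> mV V0.
have mh : measurable_fun [set: st R * bool * TR]
  (fun z => V (sample z.1.1 z.1.2 z.2)).
  exact: (measurableT_comp mV (measurable_sample a p01 p11)).
by apply: (measurable_fun_fubini_tonelli_F (m2 := unif) _ mh) => z.
Qed.

Lemma next_mean_ge0 V s u : (forall s, 0 <= V s) -> 0 <= next_mean V s u.
Proof. by move=> V0; apply: integral_ge0 => v _. Qed.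

Let mVs V s u : measurable_fun setT V -> measurable_fun [set: TR]
  (V \o sample s u).
Proof. by move=> mV; apply: (measurableT_comp mV); exact: measurable_sample_at.
  Qed.

(** Comparing on [st_space] is enough because [sample] always lands there. *)
Lemma le_next_mean V V' s u : measurable_fun setT V -> measurable_fun setT V' ->
  (forall s, 0 <= V s) -> (forall s, st_space s -> V s <= V' s) ->
  next_mean V s u <= next_mean V' s u.
Proof.
move=> mV mV' V0 VV'; apply: ge0_le_integral => //.
- exact: mVs.
- exact: mVs.
- by move=> v _; apply: VV'; exact: sample_st_space.
Qed.

Definition stage s u : \bar R := (s.1 ^+ 2 + lam * (u : nat)%:R)%:E.

Lemma stage_ge0 s u : 0 <= stage s u.
Proof. by rewrite lee_fin addr_ge0 ?sqr_ge0 ?mulr_ge0. Qed.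

Lemma measurable_stage : measurable_fun [set: st R * bool]
  (fun z => stage z.1 z.2).
Proof.
have me : measurable_fun [set: st R * bool] (fun z => z.1.1 : TR).
  exact: measurableT_comp measurable_fst measurable_fst.
apply/measurable_EFinP; apply: measurable_funD; first exact: measurable_funX.
apply: measurable_funM => //.
have mn : measurable_fun [set: bool] (fun u : bool => ((u : nat)%:R : TR)) by
  [].
exact: (measurableT_comp mn measurable_snd).
Qed.

(** Counterpart of [Qfun] that stays monotone off [st_space], thanks to the clamped belief; [QfunE]
    identifies the two on [st_space]. *)
Definition bellman V s u : \bar R := stage s u + beta%:E * next_mean V s u.

Lemma bellman_ge0 V s u : (forall s, 0 <= V s) -> 0 <= bellman V s u.
Proof.
move=> V0; apply: adde_ge0; first exact: stage_ge0.
by apply: mule_ge0; [rewrite lee_fin;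
  case/andP: hbeta => /ltW|exact: next_mean_ge0].
Qed.

Lemma measurable_bellman V : measurable_fun setT V -> (forall s, 0 <= V s) ->
  measurable_fun [set: st R * bool] (fun z => bellman V z.1 z.2).
Proof.
move=> mV V0; apply: emeasurable_funD; first exact: measurable_stage.
by apply: measurable_funeM; exact: measurable_next_mean.
Qed.

Lemma le_bellman V V' s u : measurable_fun setT V -> measurable_fun setT V' ->
  (forall s, 0 <= V s) -> (forall s, st_space s -> V s <= V' s) ->
  bellman V s u <= bellman V' s u.
Proof.
move=> mV mV' V0 VV'; apply: leeD2l; apply: lee_wpmul2l;
  first by rewrite lee_fin; case/andP: hbeta => /ltW.
exact: le_next_mean.
Qed.

Lemma QfunE V s u : measurable_fun setT V -> (forall s, 0 <= V s) ->
  st_space s ->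
  Qfun a lam beta p01 p11 V s u = bellman V s u.
Proof.
move=> mV V0 ss; rewrite /bellman next_meanE// /Qfun /stage; case: u.
- rewrite mulr1; congr (_ + _ * _).
  have /andP[b0 b1] : (0 <= s.2 <= 1)%R := ss.
  have mg1 : measurable_fun [set: TR] (fun w : TR => V (w, p11)).
    by apply: (measurableT_comp mV); exact: measurable_fun_pair.
  have mg2 c : measurable_fun [set: TR] (fun w : TR => V (a * s.1 + w, c)%R).
    apply: (measurableT_comp mV); apply: measurable_fun_pair => //.
    exact: measurable_funD.
  rewrite ge0_integralD//; first last.
  - by apply: measurable_funeM.
  - by move=> w _; rewrite mule_ge0// lee_fin subr_ge0.
  - by apply: measurable_funeM.
  - by move=> w _; rewrite mule_ge0// lee_fin.
  by rewrite !ge0_integralZl_EFin ?subr_ge0.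
- by rewrite mulr0 addr0.
Qed.

(** Used to substitute functions, such as [opt_value], that are identified only on [st_space]. *)
Lemma eq_Qfun V V' s u : (forall s, st_space s -> V s = V' s) -> st_space s ->
  Qfun a lam beta p01 p11 V s u = Qfun a lam beta p01 p11 V' s u.
Proof.
move=> VV' ss; have /andP[b0 b1] : (0 <= s.2 <= 1)%R := ss.
rewrite /Qfun; case: u; congr (_ + _ * _); apply: eq_integral => w _.
- by rewrite !VV'.
- rewrite VV'// /st_space /belief_step/=.
  case/andP: hp01 hp11 => h0 h1 /andP[h2 h3]; apply/andP; split; nra.
Qed.

End optimality_operator.

(** * Value iteration and its limit *)

Section value_iteration.
Variables (R : realType) (a lam beta p01 p11 : R).
Hypotheses (hlam : 0 <= lam) (hbeta : 0 < beta < 1)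
  (hp01 : 0 <= p01 <= 1) (hp11 : 0 <= p11 <= 1).
Local Notation TR := (measurableTypeR R).
Implicit Types (s : st R) (u : bool) (V : st R -> \bar R).
Local Notation next_mean := (next_mean a p01 p11).
Local Notation bellman := (bellman a lam beta p01 p11).
Local Notation stage := (stage lam).

Local Open Scope ereal_scope.

(* Agrees with [value_iter] on [st_space] and, unlike it, is nonnegative and
   measurable on the whole ambient type. *)
Definition value_iterc n : st R -> \bar R :=
  iter n (fun V s => mine (bellman V s false) (bellman V s true)) (fun=> 0).
Local Notation W := value_iterc.

Lemma value_iterc_ge0 n s : 0 <= W n s.
Proof.
elim: n s => [|n ih] s //=.
by rewrite le_min !bellman_ge0.
Qed.

Lemma measurable_bellman_at V u : measurable_fun setT V ->
  (forall s, 0 <= V s) ->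
  measurable_fun [set: st R] (bellman V ^~ u).
Proof.
move=> mV V0.
exact: (measurableT_comp (measurable_bellman a lam beta p01 p11 mV V0)
  (pair2_measurable u)).
Qed.

Lemma measurable_value_iterc n : measurable_fun [set: st R] (W n).
Proof.
elim: n => [|n ih]; first exact: measurable_cst.
by apply: measurable_mine; apply: measurable_bellman_at => //;
  exact: value_iterc_ge0.
Qed.

Lemma value_iterc_nd s : nondecreasing_seq (W ^~ s).
Proof.
apply/nondecreasing_seqP => n; elim: n s => [|n ih] s;
  first exact: (value_iterc_ge0 1).
have h u : bellman (W n) s u <= bellman (W n.+1) s u.
  have mWn := measurable_value_iterc n; have mWn1 :=
    measurable_value_iterc n.+1.
  by apply: le_bellman => //; exact: value_iterc_ge0.
change (mine (bellman (W n) s false) (bellman (W n) s true) <=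
  mine (bellman (W n.+1) s false) (bellman (W n.+1) s true)).
exact: le_mine2 (h false) (h true).
Qed.

Lemma value_iterE n s : st_space s ->
  value_iter a lam beta p01 p11 n s = W n s.
Proof.
elim: n s => [//|n ih] s ss; rewrite /= -/(value_iter a lam beta p01 p11 n)
  /min_Qfun.
have mW := measurable_value_iterc n; have W0 := value_iterc_ge0 n.
have E u : Qfun a lam beta p01 p11 (value_iter a lam beta p01 p11 n) s u =
  bellman (W n) s u.
  by rewrite -(QfunE a lam beta p01 p11 u mW W0 ss); exact: eq_Qfun.
by rewrite !E.
Qed.

Definition value_lim s : \bar R := limn (W ^~ s).

Lemma cvg_value_iterc s : W ^~ s @ \oo --> value_lim s.
Proof. by apply: ereal_nondecreasing_is_cvgn; exact: value_iterc_nd. Qed.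

Lemma le_value_lim n s : W n s <= value_lim s.
Proof.
by rewrite /value_lim
  (cvg_lim _ (ereal_nondecreasing_cvgn (@value_iterc_nd s)))//;
  apply: ereal_sup_ubound; exists n.
Qed.

Lemma value_lim_ge0 s : 0 <= value_lim s.
Proof. exact: (le_value_lim 0). Qed.

Lemma measurable_value_lim : measurable_fun [set: st R] value_lim.
Proof.
apply: (emeasurable_fun_cvg W); first exact: measurable_value_iterc.
by move=> s _; exact: cvg_value_iterc.
Qed.

Lemma cvg_bellman s u : bellman (W n) s u @[n --> \oo] -->
  bellman value_lim s u.
Proof.
have b0 : beta%:E \is a fin_num by [].
apply: cvgeD; first exact: fin_num_adde_defr.
  exact: cvg_cst.
apply: cvgeZl => //.
apply: cvg_monotone_convergence => //.
- move=> n; apply: (measurableT_comp (measurable_value_iterc n)).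
  exact: measurable_sample_at.
- by move=> *; exact: value_iterc_ge0.
- by move=> v _ m n mn; exact: value_iterc_nd.
Qed.

Lemma value_lim_bellman s :
  value_lim s = mine (bellman value_lim s false) (bellman value_lim s true).
Proof.
have h : W n.+1 s @[n --> \oo] --> value_lim s.
  by have := @cvg_value_iterc s; rewrite -cvg_shiftS.
have hm : W n.+1 s @[n --> \oo] --> mine (bellman value_lim s false)
  (bellman value_lim s true).
  apply: (@continuous2_cvg _ _ _ _ _ _ _ _ Order.min); last 2 first.
  - exact: cvg_bellman.
  - exact: cvg_bellman.
  - exact: (@min_continuous _ (\bar R) (_, _)).
exact: (cvg_unique _ h hm).
Qed.

(** Every iterate stays below [V] by induction, since the minimum is at most the cost of
    transmitting and [bellman] is monotone. *)
Lemma value_lim_le_supersolution V : measurable_fun setT V ->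
  (forall s, 0 <= V s) ->
  (forall s, st_space s -> bellman V s true <= V s) ->
  forall s, st_space s -> value_lim s <= V s.
Proof.
move=> mV V0 sV s ss; apply: lime_le; first exact: cvg_value_iterc.
apply: nearW => n; elim: n s ss => [|n ih] s ss; first exact: V0.
change (mine (bellman (W n) s false) (bellman (W n) s true) <= V s).
rewrite ge_min; apply/orP; right; apply: le_trans (sV s ss).
apply: le_bellman => //; first exact: measurable_value_iterc.
exact: value_iterc_ge0.
Qed.

End value_iteration.

(** * Finiteness of the value *)

Section second_moment.
Variable R : realType.
Local Notation TR := (measurableTypeR R).
Local Notation mu := (@lebesgue_measure R).
Local Open Scope ereal_scope.

Lemma integral_normal_prob (m sigma : R) (f : TR -> \bar R) :
  measurable_fun setT f -> (forall x, 0 <= f x) ->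
  \int[normal_prob m sigma]_x f x = \int[mu]_x
    (f x * (normal_pdf m sigma x)%:E).
Proof.
move=> mf f0; have dom := @normal_prob_dominates R m sigma.
rewrite -(Radon_Nikodym_SigmaFinite.change_of_variables dom)//.
have i1 := Radon_Nikodym_SigmaFinite.f_integrable dom.
have i2 := integrable_normal_pdf m sigma.
apply: ae_eq_integral => //.
- by apply: emeasurable_funM => //; exact: (measurable_int _ i1).
- by apply: emeasurable_funM => //; exact: (measurable_int _ i2).
(* The Radon-Nikodym derivative and the normal density have the same integral over every measurable
   set. *)
- apply: ae_eqe_mul2l; apply: integral_ae_eq => //;
    first exact: (measurable_int _ i2).
  by move=> A _ mA; rewrite -Radon_Nikodym_SigmaFinite.f_integral.
Qed.

(** Dominates the second moment by a wider Gaussian of known integral. The exponents for deviations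
    1 and 2 differ by [3/8 w^2] (from [1/2 - 1/8]), and [1 + 3/8 w^2 <= exp(3/8 w^2)] gives the
    factor 8/3. *)
Let normal2 (w : R) :
  (w ^+ 2 * normal_pdf 0 1 w <= 8 / 3 * normal_peak 1 / normal_peak 2 *
    normal_pdf 0 2 w)%R.
Proof.
have p1 : (0 < normal_peak (1 : R))%R by exact: normal_peak_gt0.
have p2 : (0 < normal_peak (2 : R))%R by exact: normal_peak_gt0.
rewrite !normal_pdfE// /normal_fun !subr0.
rewrite [leRHS](_ : _ = normal_peak 1 *
  (8 / 3 * expR (- w ^+ 2 / (2 ^+ 2 *+ 2))))%R; last first.
  by field; rewrite gt_eqF.
rewrite mulrCA ler_pM2l//.
have -> : (- w ^+ 2 / (1 ^+ 2 *+ 2) = - w ^+ 2 / (2 ^+ 2 *+ 2) + -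
  (3 / 8 * w ^+ 2))%R.
  by rewrite !mulr2n; field.
rewrite expRD mulrCA mulrA [leRHS]mulrC -mulrA ler_pM2l ?expR_gt0// expRN.
rewrite ler_pdivrMr ?expR_gt0//.
have := expR_ge1Dx (3 / 8 * w ^+ 2)%R; lra.
Qed.

Lemma second_moment_lty : \int[noise R]_w (w ^+ 2)%:E < +oo.
Proof.
have m2 : measurable_fun [set: TR] (fun w : TR => (w ^+ 2)%:E).
  by apply/measurable_EFinP; exact: measurable_funX.
have p1 : (0 < normal_peak (1 : R))%R by exact: normal_peak_gt0.
have p2 : (0 < normal_peak (2 : R))%R by exact: normal_peak_gt0.
pose C : R := (8 / 3 * normal_peak 1 / normal_peak 2)%R.
have C0 : (0 <= C)%R by rewrite /C; apply: divr_ge0;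
  [apply: mulr_ge0; [lra|exact: ltW]|exact: ltW].
rewrite integral_normal_prob//; last by move=> w; rewrite lee_fin sqr_ge0.
apply: (@le_lt_trans _ _ (\int[mu]_w (C%:E * (normal_pdf 0 2 w)%:E))).
  apply: ge0_le_integral => //=.
  - by move=> w _; rewrite mule_ge0// lee_fin ?sqr_ge0 ?normal_pdf_ge0.
  - apply: emeasurable_funM => //; apply/measurable_EFinP;
      exact: measurable_normal_pdf.
  - apply: measurable_funeM; apply/measurable_EFinP;
      exact: measurable_normal_pdf.
  - by move=> w _; rewrite -!EFinM lee_fin; exact: normal2.
rewrite ge0_integralZl_EFin//.
- by rewrite integral_normal_pdf mule1 ltry.
- by move=> w _; rewrite lee_fin normal_pdf_ge0.
- by apply/measurable_EFinP; exact: measurable_normal_pdf.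
Qed.

Definition moment2 : R := fine (\int[noise R]_w (w ^+ 2)%:E).

Lemma moment2_ge0 : (0 <= moment2)%R.
Proof. by apply: fine_ge0; apply: integral_ge0 => w _; rewrite lee_fin sqr_ge0.
  Qed.

Lemma integral_noise_quadratic (k d : R) : (0 <= k)%R -> (0 <= d)%R ->
  \int[noise R]_w (k * w ^+ 2 + d)%:E = (k * moment2 + d)%:E.
Proof.
move=> k0 d0.
have m2 : measurable_fun [set: TR] (fun w : TR => (w ^+ 2)%:E).
  by apply/measurable_EFinP; exact: measurable_funX.
have fin2 : (\int[noise R]_w (w ^+ 2)%:E) = moment2%:E.
  rewrite /moment2 fineK// ge0_fin_numE ?second_moment_lty//.
  by apply: integral_ge0 => w _; rewrite lee_fin sqr_ge0.
under eq_integral do rewrite EFinD EFinM.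
rewrite ge0_integralD//.
- rewrite ge0_integralZl_EFin//; last by move=> w _; rewrite lee_fin sqr_ge0.
  by rewrite fin2 (integral_prob_cst (noise R) d%:E).
- by move=> w _; rewrite mule_ge0// lee_fin sqr_ge0.
- exact: measurable_funeM.
Qed.

End second_moment.

Section finiteness.
Variables (R : realType) (a lam beta p01 p11 : R).
Hypotheses (hlam : 0 <= lam) (hbeta : 0 < beta < 1)
  (hp01 : 0 <= p01 <= 1) (hp11 : 0 <= p11 <= 1)
  (ha : a ^+ 2 * (1 - p01) < 1).
Local Notation TR := (measurableTypeR R).
Local Notation M := (moment2 R).
Local Open Scope ereal_scope.

(* Always transmitting costs at most [e^2 (1 + c (1 - b)) + D]; [c] solves
   [c = a^2 (1 + c (1 - p01))], so that the coefficient of [e^2] is preserved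
   after a failed transmission. *)
Let c : R := (a ^+ 2 / (1 - a ^+ 2 * (1 - p01)))%R.
(** [X] bounds the noise term after a success and [Y] the one after a failure, where Young's
    inequality costs a factor [1 / (1 - beta)]. [D] solves [D = lam + Y + beta D]. *)
Let X : R := ((1 + c) * M)%R.
Let Y : R := (X / (1 - beta))%R.
Let D : R := ((lam + Y) / (1 - beta))%R.
Let Phi (s : st R) : \bar R := (s.1 ^+ 2 * (1 + c * (1 - clamp s.2)) + D)%:E.

Let c0 : (0 <= c)%R.
Proof. by rewrite divr_ge0 ?sqr_ge0// subr_ge0 ltW. Qed.

Let cE : (a ^+ 2 * (1 + c * (1 - p01)) = c)%R.
Proof. by rewrite /c; field; rewrite subr_eq0 gt_eqF. Qed.

Let X0 : (0 <= X)%R.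
Proof. by rewrite mulr_ge0 ?moment2_ge0// addr_ge0. Qed.

Let beta1 : (0 < 1 - beta)%R. Proof. by rewrite subr_gt0; case/andP: hbeta. Qed.

Let Y0 : (0 <= Y)%R. Proof. by rewrite divr_ge0// ltW. Qed.

Let D0 : (0 <= D)%R. Proof. by apply: divr_ge0; [exact: addr_ge0|exact: ltW].
  Qed.

Let mPhi : measurable_fun [set: st R] Phi.
Proof.
apply/measurable_EFinP; apply: measurable_funD => //; apply: measurable_funM.
  exact: measurable_funX.
apply: measurable_funD => //; apply: measurable_funM => //;
  apply: measurable_funB => //.
exact: (measurableT_comp (@measurable_clamp R) measurable_snd).
Qed.

Let Phi0 s : 0 <= Phi s.
Proof.
have /andP[_ h] := clamp_bounds s.2.
by rewrite lee_fin addr_ge0// mulr_ge0 ?sqr_ge0// addr_ge0// mulr_ge0//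
  subr_ge0.
Qed.

Let Phi_super s : st_space s -> bellman a lam beta p01 p11 Phi s true <= Phi s.
Proof.
move=> ss; have /andP[b0 b1] : (0 <= s.2 <= 1)%R := ss.
have /andP[be0 be1] := hbeta.
rewrite /bellman next_meanE// /stage mulr1.
have mw : measurable_fun [set: TR] (fun w : TR => (w, p11) : st R).
  exact: measurable_fun_pair.
have maw : measurable_fun [set: TR] (fun w : TR => (a * s.1 + w, p01)%R : st R).
  by apply: measurable_fun_pair => //; exact: measurable_funD.
have mq (k d : R) : measurable_fun [set: TR]
  (fun w : TR => (k * w ^+ 2 + d)%:E).
  apply/measurable_EFinP; apply: measurable_funD => //.
  by apply: measurable_funM => //; exact: measurable_funX.
have I1 : \int[noise R]_w Phi (w, p11) <= (X + D)%:E.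
  have := @integral_noise_quadratic R (1 + c)%R D.
  rewrite addr_ge0// D0 => <- //; apply: ge0_le_integral => //.
    exact: (measurableT_comp mPhi mw).
  move=> w _; rewrite lee_fin lerD2r /= mulrC ler_wpM2r ?sqr_ge0// clamp_id//.
  rewrite lerD2l ler_piMr// lerBlDr lerDl; by case/andP: hp11.
(* The inherited error contributes [(a e)^2 / beta] times [1 + c (1 - p01)], which is [c e^2 / beta]
   by [cE]. *)
pose d2 : R := (c * s.1 ^+ 2 / beta + D)%R.
have I2 : \int[noise R]_w Phi (a * s.1 + w, p01)%R <= (Y + d2)%:E.
  have k0 : (0 <= (1 + c) / (1 - beta))%R by apply: divr_ge0;
    [exact: addr_ge0|exact: ltW].
  have d20 : (0 <= d2)%R.
    by apply: addr_ge0 => //; apply: divr_ge0;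
      [apply: mulr_ge0 => //; exact: sqr_ge0|exact: ltW].
  have -> : (Y + d2 = (1 + c) / (1 - beta) * M + d2)%R by rewrite /Y /X mulrAC.
  rewrite -integral_noise_quadratic//; apply: ge0_le_integral => //.
    exact: (measurableT_comp mPhi maw).
  move=> w _; rewrite lee_fin /= clamp_id// /d2 addrA lerD2r.
  (* Young's inequality removes the cross term. The weight [1 / beta] is chosen so that the discount
     factor cancels it. *)
  have h : ((a * s.1 + w) ^+ 2 <= (a * s.1) ^+ 2 / beta + w ^+ 2 /
    (1 - beta))%R.
    rewrite -subr_ge0.
    have -> : ((a * s.1) ^+ 2 / beta + w ^+ 2 / (1 - beta) -
      (a * s.1 + w) ^+ 2 =
      ((1 - beta) * (a * s.1) - beta * w) ^+ 2 / (beta * (1 - beta)))%R.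
      by field; rewrite !gt_eqF.
    by rewrite divr_ge0 ?sqr_ge0// mulr_ge0// ltW.
  set k := (1 + c * (1 - p01))%R.
  have /andP[q0 q1] := hp01.
  have kpos : (0 <= k)%R by rewrite addr_ge0// mulr_ge0// subr_ge0.
  have kc : (k <= 1 + c)%R by rewrite lerD2l ler_piMr// lerBlDr lerDl.
  apply: (le_trans (ler_wpM2r kpos h)).
  rewrite mulrDl [leRHS]addrC; apply: lerD.
    rewrite le_eqVlt; apply/orP; left; apply/eqP.
    by rewrite -[in RHS]cE -/k exprMn; field; rewrite gt_eqF.
  rewrite [leLHS]mulrC [leRHS]mulrAC -[leRHS]mulrA; apply: ler_wpM2r => //.
  by apply: divr_ge0; [exact: sqr_ge0|exact: ltW].
apply: (@le_trans _ _ ((s.1 ^+ 2 + lam)%:E + beta%:E *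
  (s.2%:E * (X + D)%:E + (1 - s.2)%:E * (Y + d2)%:E))).
  apply: leeD2l; apply: lee_wpmul2l; first by rewrite lee_fin ltW.
  by apply: leeD; apply: lee_wpmul2l => //; rewrite lee_fin// subr_ge0.
rewrite -!EFinM -EFinD lee_fin clamp_id//.
have DE : (D * (1 - beta) = lam + Y)%R by rewrite /D divfK// gt_eqF.
have YE : (Y * (1 - beta) = X)%R by rewrite /Y divfK// gt_eqF.
have d2E : (beta * d2 = c * s.1 ^+ 2 + beta * D)%R by rewrite /d2; field;
  rewrite gt_eqF.
have XY : (X <= Y)%R by rewrite -YE ler_piMr// gerBl ltW.
(* The coefficient of [e^2] already matches exactly. Together [h1] and [h2] bound the noise terms by
   [Y], and [lam + Y + beta D = D] closes the estimate. *)
have h1 : (beta * s.2 * X <= s.2 * Y)%R.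
  rewrite -mulrA mulrCA ler_wpM2l//; apply: le_trans XY.
  by rewrite ler_piMl// ltW.
have h2 : (beta * (1 - s.2) * Y <= (1 - s.2) * Y)%R.
  rewrite -mulrA; apply: ler_piMl; last exact: ltW.
  by apply: mulr_ge0 => //; rewrite subr_ge0.
have -> : (s.1 ^+ 2 + lam + beta * (s.2 * (X + D) + (1 - s.2) * (Y + d2)) =
   s.1 ^+ 2 + lam + beta * s.2 * X + beta * (1 - s.2) * Y + beta * s.2 * D +
     (1 - s.2) * (beta * d2))%R.
  by ring.
rewrite d2E; lra.
Qed.

Lemma value_lim_fin_num s : st_space s ->
  value_lim a lam beta p01 p11 s \is a fin_num.
Proof.
move=> ss; rewrite ge0_fin_numE; last exact: value_lim_ge0.
apply: le_lt_trans (ltry _).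
exact: (value_lim_le_supersolution hlam hbeta hp01 hp11 mPhi Phi0 Phi_super ss).
Qed.

End finiteness.

(** * Path laws *)

Section trajectories.
Variable R : realType.
Local Notation TR := (measurableTypeR R).
Local Notation E := (st R * bool)%type.

Lemma measurable_coord t : measurable_fun [set: traj R]
  (fun om : traj R => om t : E).
Proof.
move=> _ B mB; rewrite setTI; apply: sub_sigma_algebra.
by exists t => //; exists B => //; rewrite setTI.
Qed.

Lemma measurable_trajP d (T : measurableType d) (f : T -> traj R) :
  (forall t, measurable_fun setT (fun z => f z t : E)) -> measurable_fun setT f.
Proof.
move=> mf; apply: (@measurability _ _ T (traj R) setT f (@cylinders R)) => //.
move=> _ [_ [t _ [B mB <-]] <-]; rewrite setTI.
exact: mf.
Qed.

Lemma measurable_past t : measurable_fun [set: traj R] (past t : traj R ->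
  t.-tuple E).
Proof.
apply/measurable_fun_tnthP => i.
apply: (eq_measurable_fun (fun om : traj R => om i));
  last exact: measurable_coord.
by move=> om _; rewrite /= tnth_mktuple.
Qed.

Lemma eq_past t (om om' : traj R) : (forall i, (i < t)%N -> om i = om' i) ->
  past t om = past t om'.
Proof. by move=> h; apply/eq_from_tnth => i; rewrite !tnth_mktuple h. Qed.

Lemma measurable_sample_next (a p01 p11 : R) t :
  measurable_fun [set: traj R * TR]
    (fun z => sample a p01 p11 (z.1 t).1 (z.1 t).2 z.2).
Proof.
have mc : measurable_fun [set: traj R * TR] (fun z => z.1 t : E).
  exact: (measurableT_comp (@measurable_coord t) measurable_fst).
have mp : measurable_fun [set: traj R * TR]
    (fun z => ((z.1 t).1, (z.1 t).2, z.2) : E * TR).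
  apply: measurable_fun_pair => //; apply: measurable_fun_pair.
    exact: (measurableT_comp measurable_fst mc).
  exact: (measurableT_comp measurable_snd mc).
exact: (measurableT_comp (measurable_sample a p01 p11) mp).
Qed.

End trajectories.

(** * The controlled process driven by one uniform variable *)

Section construction.
Variables (R : realType) (a p01 p11 : R) (phi : policy R) (x : st R).
Local Notation TR := (measurableTypeR R).
Local Notation E := (st R * bool)%type.
Local Notation sample := (sample a p01 p11).

Definition path_next t (om : traj R) (v : TR) : traj R := fun i =>
  if (i <= t)%N then om i else
  (sample (om t).1 (om t).2 v, phi t.+1 (past t.+1 om, sample (om t).1
    (om t).2 v)).

Definition remaining t (w : TR) : TR := iter t odd_bits w.

(* The trajectory up to time [t], frozen afterwards; it depends on [w] only
   through the bits that [remaining t w] does not use. *)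
Fixpoint path_upto t (w : TR) : traj R :=
  if t is t'.+1 then path_next t' (path_upto t' w) (even_bits (remaining t' w))
  else fun=> (x, phi 0 (past 0 (fun=> (x, false)), x)).

Definition sample_path (w : TR) : traj R := fun t => path_upto t w t.

Lemma path_uptoE t i w : (i <= t)%N -> path_upto t w i = sample_path w i.
Proof.
elim: t => [|t ih]; first by rewrite leqn0 => /eqP ->.
by rewrite leq_eqVlt => /orP[/eqP -> //|]; rewrite ltnS => it;
  rewrite /= /path_next it ih.
Qed.

Lemma past_path t w : past t.+1 (path_upto t w) = past t.+1 (sample_path w).
Proof. by apply: eq_past => i; rewrite ltnS => /path_uptoE ->. Qed.

Lemma path0 w : (sample_path w 0).1 = x.
Proof. by []. Qed.

Lemma pathS t w : (sample_path w t.+1).1 =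
  sample (path_upto t w t).1 (path_upto t w t).2 (even_bits (remaining t w)).
Proof. by rewrite /sample_path /= /path_next ltnn. Qed.

Lemma path_action t w : (sample_path w t).2 = phi t
  (past t (sample_path w), (sample_path w t).1).
Proof.
case: t => [|t].
  (* [past 0] reads no coordinate, so the dummy trajectory used at time 0 agrees with any other. *)
  by rewrite /sample_path /=; congr (phi 0 (_, x)); exact: eq_past.
by rewrite pathS -past_path /sample_path /= /path_next ltnn.
Qed.

Lemma path_st_space t w : st_space x -> 0 <= p01 <= 1 -> 0 <= p11 <= 1 ->
  st_space (sample_path w t).1.
Proof.
move=> sx h0 h1; case: t => [|t]; first by rewrite path0.
by rewrite pathS; exact: sample_st_space.
Qed.

Lemma measurable_path_next t :
  measurable_fun [set: traj R * TR] (fun z => path_next t z.1 z.2).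
Proof.
have mc i : measurable_fun [set: traj R * TR] (fun z => z.1 i : E).
  exact: (measurableT_comp (@measurable_coord R i) measurable_fst).
have ms := measurable_sample_next a p01 p11 t.
apply: measurable_trajP => i; rewrite /path_next; case: leqP => // _.
apply: measurable_fun_pair => //.
have mp : measurable_fun [set: traj R * TR]
    (fun z => (past t.+1 z.1, sample (z.1 t).1 (z.1 t).2 z.2)).
  apply: measurable_fun_pair => //.
  exact: (measurableT_comp (@measurable_past R t.+1) measurable_fst).
exact: (measurableT_comp (measurable_funPT (phi t.+1)) mp).
Qed.

Lemma measurable_remaining t : measurable_fun [set: TR] (remaining t).
Proof.
elim: t => [|t ih]; first exact: measurable_id.
exact: (measurableT_comp measurable_odd_bits ih).
Qed.

Lemma measurable_path_upto t : measurable_fun [set: TR] (path_upto t).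
Proof.
elim: t => [|t ih]; first exact: measurable_cst.
have mp : measurable_fun [set: TR]
  (fun w => (path_upto t w, even_bits (remaining t w)) : traj R * TR).
  apply: measurable_fun_pair => //.
  exact: (measurableT_comp measurable_even_bits (measurable_remaining t)).
exact: (measurableT_comp (measurable_path_next t) mp).
Qed.

Lemma measurable_path : measurable_fun [set: TR] sample_path.
Proof.
apply: measurable_trajP => t.
exact: (measurableT_comp (@measurable_coord R t) (measurable_path_upto t)).
Qed.

Local Open Scope ereal_scope.

(* The path up to time [t] is independent of the bits not yet used. *)
Lemma integral_path_remaining t (h : traj R * TR -> \bar R) :
  measurable_fun setT h -> (forall z, 0 <= h z) ->
  \int[unif]_w h (path_upto t w, remaining t w) =
  \int[unif]_w \int[unif]_v h (path_upto t w, v).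
Proof.
elim: t h => [|t ih] h mh h0.
  exact: (esym (integral_prob_cst unif (\int[unif]_v h (path_upto 0 0%R, v)))).
have mnx (f : traj R * TR -> TR) (g : traj R * TR -> TR) :
    measurable_fun setT f -> measurable_fun setT g ->
    measurable_fun [set: traj R * TR] (fun z => h (path_next t z.1 (f z), g z)).
  move=> mf mg.
  have m1 : measurable_fun [set: traj R * TR] (fun z => (z.1, f z)).
    exact: measurable_fun_pair.
  have m2 : measurable_fun [set: traj R * TR] (fun z => path_next t z.1 (f z)).
    exact: (measurableT_comp (measurable_path_next t) m1).
  have m3 : measurable_fun [set: traj R * TR]
    (fun z => (path_next t z.1 (f z), g z)).
    exact: measurable_fun_pair.
  exact: (measurableT_comp mh m3).
have me : measurable_fun [set: traj R * TR] (fun z => even_bits z.2 : TR).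
  exact: (measurableT_comp measurable_even_bits measurable_snd).
have mo : measurable_fun [set: traj R * TR] (fun z => odd_bits z.2 : TR).
  exact: (measurableT_comp measurable_odd_bits measurable_snd).
have mh2 om : measurable_fun [set: TR * TR]
  (fun z => h (path_next t om z.1, z.2)).
  have m1 : measurable_fun [set: TR * TR] (fun z => path_next t om z.1).
    have m0 : measurable_fun [set: TR * TR] (fun z => (om, z.1)) by
      exact: measurable_fun_pair.
    exact: (measurableT_comp (measurable_path_next t) m0).
  have m3 : measurable_fun [set: TR * TR] (fun z => (path_next t om z.1, z.2)).
    exact: measurable_fun_pair.
  exact: (measurableT_comp mh m3).
(* The induction hypothesis is applied to both sides: to [k], where the leftover bits drive the next
   step and also remain as the future, and to [k2], where the future is already averaged out. For a
   frozen path the two agree by independence of even and odd digits. *)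
pose k (z : traj R * TR) := h (path_next t z.1 (even_bits z.2), odd_bits z.2).
pose k2 (z : traj R * TR) := \int[unif]_y h (path_next t z.1 (even_bits z.2),
  y).
have mk2 : measurable_fun setT k2.
  have m1 : measurable_fun [set: traj R * TR * TR]
      (fun z => path_next t z.1.1 (even_bits z.1.2)).
    have m0 : measurable_fun [set: traj R * TR]
      (fun z => (z.1, even_bits z.2) : traj R * TR).
      exact: measurable_fun_pair.
    have m0' := measurableT_comp (measurable_path_next t) m0.
    exact: (measurableT_comp m0' measurable_fst).
  have m3 : measurable_fun [set: traj R * TR * TR]
      (fun z => (path_next t z.1.1 (even_bits z.1.2), z.2)).
    exact: measurable_fun_pair.
  have mh' := measurableT_comp mh m3.
  by apply: (measurable_fun_fubini_tonelli_F (m2 := unif) _ mh') => z;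
    exact: h0.
have k20 z : 0 <= k2 z by apply: integral_ge0.
transitivity (\int[unif]_w k (path_upto t w, remaining t w)); first by [].
transitivity (\int[unif]_w k2 (path_upto t w, remaining t w)); last by [].
have mk : measurable_fun setT k by exact: mnx me mo.
rewrite (ih k mk); last by move=> z; exact: h0.
rewrite (ih k2 mk2 k20).
apply: eq_integral => w _.
pose k3 v := \int[unif]_y h (path_next t (path_upto t w) v, y).
have mk3 : measurable_fun [set: TR] k3.
  by apply: (measurable_fun_fubini_tonelli_F (m2 := unif) _
    (mh2 (path_upto t w))) => z; exact: h0.
have k30 v : 0 <= k3 v by apply: integral_ge0.
transitivity (\int[unif]_v k3 v).
  exact: (integral_bits (mh2 (path_upto t w)) (fun z => h0 _)).
exact: (esym (integral_even_bits mk3 k30)).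
Qed.

End construction.

Section transition_law.
Variables (R : realType) (a p01 p11 : R).
Local Notation TR := (measurableTypeR R).
Local Notation E := (st R * bool)%type.
Local Notation sample := (sample a p01 p11).
Local Open Scope ereal_scope.

Lemma measurable_st_space : measurable (@st_space R).
Proof.
have ms : measurable_fun [set: st R] (fun s => s.2 : TR) by
  exact: measurable_snd.
rewrite (_ : @st_space R = (fun s => s.2 : TR) @^-1` `[0%R, 1%R]%classic).
  by apply: measurable_preimageT => //; exact: measurable_itv.
by apply/seteqP; split => s /=; rewrite in_itv.
Qed.

Lemma measurable_sample_law (A : set (st R)) : measurable A ->
  measurable_fun [set: E] (fun z : E => unif (sample z.1 z.2 @^-1` A)).
Proof.
move=> mA; apply: (measurable_section_measure unif
  (Z := (fun z => sample z.1.1 z.1.2 z.2) @^-1` A)).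
exact: measurable_preimageT (measurable_sample a p01 p11) mA.
Qed.

Lemma measurable_trans (A : set (st R)) : measurable A ->
  measurable_fun [set: E] (fun z : E => trans a p01 p11 z.1 z.2 A).
Proof.
move=> mA.
have mF (F : E * TR -> st R) : measurable_fun setT F ->
    measurable_fun [set: E]
      (fun z : E => noise R ((fun w => F (z, w)) @^-1` A)).
  move=> mF; apply: (measurable_section_measure (noise R) (Z := F @^-1` A)).
  exact: measurable_preimageT mF mA.
have mw : measurable_fun [set: E * TR] (fun z => z.2 : TR) by
  exact: measurable_snd.
have ms : measurable_fun [set: E * TR] (fun z => z.1.1 : st R).
  exact: (measurableT_comp measurable_fst measurable_fst).
have me : measurable_fun [set: E * TR] (fun z => a * z.1.1.1 + z.2 : TR)%R.
  apply: measurable_funD => //; apply: measurable_funM => //.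
  exact: (measurableT_comp measurable_fst ms).
have mb : measurable_fun [set: E] (fun z => z.1.2 : TR).
  exact: (measurableT_comp measurable_snd measurable_fst).
apply: measurable_fun_ifT; first exact: measurable_snd.
- apply: emeasurable_funD; apply: emeasurable_funM.
  + exact/measurable_EFinP.
  + by apply: (mF (fun z => (z.2, p11))); exact: measurable_fun_pair.
  + by apply/measurable_EFinP; exact: measurable_funB.
  + by apply: (mF (fun z => (a * z.1.1.1 + z.2, p01)%R));
      exact: measurable_fun_pair.
- apply: (mF (fun z => (a * z.1.1.1 + z.2, belief_step p01 p11 z.1.1.2)%R)).
  apply: measurable_fun_pair => //.
  have mb' : measurable_fun [set: E * TR] (fun z => z.1.1.2 : TR).
    exact: (measurableT_comp measurable_snd ms).
  by apply: measurable_funD; apply: measurable_funM => //;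
    exact: measurable_funB.
Qed.

Lemma measurable_st_space_at t : measurable [set om : traj R | st_space
  (om t).1].
Proof.
apply: (measurable_preimageT (f := fun om : traj R => (om t).1)).
  exact: (measurableT_comp measurable_fst (@measurable_coord R t)).
exact: measurable_st_space.
Qed.

(** The integrands agree by [transE] at states of [st_space], hence almost everywhere. *)
Lemma integral_trans (P : probability (traj R) R) t (D : set (traj R))
  (A : set (st R)) :
  measurable D -> measurable A -> P [set om | st_space (om t).1] = 1 ->
  \int[P]_(om in D) trans a p01 p11 (om t).1 (om t).2 A =
  \int[P]_(om in D) unif (sample (om t).1 (om t).2 @^-1` A).
Proof.
move=> mD mA P1; apply: ae_eq_integral => //.
- apply: measurable_funTS.
  exact: (measurableT_comp (measurable_trans mA) (@measurable_coord R t)).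
- apply: measurable_funTS.
  exact: (measurableT_comp (measurable_sample_law mA) (@measurable_coord R t)).
- apply: ae_prob1 (measurable_st_space_at t) P1 _ => om /= som _.
  exact: transE.
Qed.

End transition_law.

(** * Existence of a path law *)

Section existence.
Variables (R : realType) (a p01 p11 : R) (phi : policy R) (x : st R).
Hypotheses (hp01 : 0 <= p01 <= 1) (hp11 : 0 <= p11 <= 1) (sx : st_space x).
Local Notation TR := (measurableTypeR R).
Local Notation E := (st R * bool)%type.
Local Notation sample := (sample a p01 p11).
Local Notation sample_path := (sample_path a p01 p11 phi x).
Local Notation path_upto := (path_upto a p01 p11 phi x).
Local Open Scope ereal_scope.

Let path_mfun : {mfun TR >-> traj R} :=
  HB.pack sample_path (isMeasurableFun.Build _ _ _ _ sample_path
    (measurable_path a p01 p11 phi x)).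

Let law : probability (traj R) R := distribution unif path_mfun.

Let lawE A : law A = unif (sample_path @^-1` A).
Proof. by []. Qed.

Let law1 (A : set (traj R)) : (forall w, A (sample_path w)) -> law A = 1.
Proof.
move=> h; rewrite lawE (_ : sample_path @^-1` A = setT);
  first exact: probability_setT.
by apply/seteqP; split => // w _; exact: h.
Qed.

Let unif_even (C : set TR) : measurable C -> unif (even_bits @^-1` C) = unif C.
Proof.
move=> mC; have := unif_bits mC (@measurableT _ TR).
rewrite preimage_setT setIT => ->.
by rewrite [X in _ * X](_ : _ = 1) ?mule1//;
  exact: (@probability_setT _ _ _ unif).
Qed.

Lemma path_law_exists : exists P, is_path_law a p01 p11 phi x P.
Proof.
exists law; split.
- by apply: law1 => w; exact: path0.
- by move=> t; apply: law1 => w; exact: path_action.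
move=> t B A mB mA.
have mD : measurable [set om : traj R | B (past t.+1 om)].
  exact: (measurable_preimageT (@measurable_past R t.+1) mB).
rewrite integral_trans//; last first.
  by apply: law1 => w; exact: path_st_space.
(* The event up to time [t.+1] depends only on the path up to [t] and the leftover bits, so
   [integral_path_remaining] can average over those bits with the path frozen. *)
pose Z : set (traj R * TR) := [set z | B (past t.+1 z.1) /\
  A (sample (z.1 t).1 (z.1 t).2 (even_bits z.2))].
have mZ : measurable Z.
  apply: measurableI.
    apply: (measurable_preimageT (f := fun z : traj R * TR => past t.+1 z.1))
      => //.
    exact: (measurableT_comp (@measurable_past R t.+1) measurable_fst).
  apply: (measurable_preimageT (f := fun z : traj R * TR =>
    sample (z.1 t).1 (z.1 t).2 (even_bits z.2))) => //.
  have mp : measurable_fun [set: traj R * TR]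
      (fun z => (z.1, even_bits z.2) : traj R * TR).
    apply: measurable_fun_pair => //.
    exact: (measurableT_comp (@measurable_even_bits R) measurable_snd).
  exact: (measurableT_comp (measurable_sample_next a p01 p11 t) mp).
have mXr : measurable_fun [set: TR] (fun w => (path_upto t w, remaining t w) :
  traj R * TR).
  apply: measurable_fun_pair; first exact: measurable_path_upto.
  exact: measurable_remaining.
pose h z : \bar R := (\1_Z z)%:E.
have mh : measurable_fun setT h by apply/measurable_EFinP;
  exact: measurable_indic.
have h0 z : 0 <= h z by rewrite /h lee_fin indicE.
rewrite lawE.
transitivity (\int[unif]_w h (path_upto t w, remaining t w)).
  transitivity (unif ((fun w => (path_upto t w, remaining t w) : traj R * TR)
    @^-1` Z)).
    congr (unif _); apply/seteqP; split => w /=.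
      by rewrite pathS -past_path.
    by rewrite pathS -past_path.
  exact: (esym (integral_indic_comp unif mXr mZ)).
rewrite integral_path_remaining//.
pose g (om : traj R) := unif (sample (om t).1 (om t).2 @^-1` A).
have mg : measurable_fun [set om : traj R | B (past t.+1 om)] g.
  apply: measurable_funTS.
  exact: (measurableT_comp (measurable_sample_law a p01 p11 mA)
    (@measurable_coord R t)).
have pf := ge0_integral_pushforward (measurable_path a p01 p11 phi x) unif mD mg
  (fun _ _ => measure_ge0 _ _).
apply: (etrans _ (esym pf)).
rewrite [RHS]integral_mkcond; apply: eq_integral => w _.
have mS : measurable (sample (sample_path w t).1 (sample_path w t).2 @^-1` A).
  exact: measurable_preimageT (@measurable_sample_at R a p01 p11 _ _) mA.
rewrite patchE; case: ifPn => [|]; rewrite ?(inE, notin_setE) /= -past_path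
  => Bw.
- transitivity (unif (even_bits @^-1` (sample (sample_path w t).1
    (sample_path w t).2 @^-1` A))).
    rewrite -(integral_indic_comp unif (@measurable_even_bits R) mS).
    apply: eq_integral => v _; rewrite /h !indicE; congr (_%:R%:E).
    congr nat_of_bool; apply/idP/idP; rewrite !inE; first by case.
    by move=> ?; split.
  exact: unif_even.
- rewrite integral0_eq// => v _; rewrite /h indicE memNset//.
  by move=> [].
Qed.

End existence.

(** * Expected costs *)

Section law_properties.
Variables (R : realType) (a lam beta p01 p11 : R) (phi : policy R) (x : st R).
Hypotheses (hlam : 0 <= lam) (hbeta : 0 < beta < 1)
  (hp01 : 0 <= p01 <= 1) (hp11 : 0 <= p11 <= 1) (sx : st_space x).
Variable P : probability (traj R) R.
Hypothesis HP : is_path_law a p01 p11 phi x P.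
Local Notation TR := (measurableTypeR R).
Local Notation E := (st R * bool)%type.
Local Notation sample := (sample a p01 p11).
Local Notation next_mean := (next_mean a p01 p11).
Local Notation bellman := (bellman a lam beta p01 p11).
Local Notation stage := (stage lam).
Local Notation W := (value_iterc a lam beta p01 p11).
Local Notation V := (value_lim a lam beta p01 p11).
Local Open Scope ereal_scope.

Let mstate t : measurable_fun [set: traj R] (fun om : traj R => (om t).1 :
  st R).
Proof. exact: (measurableT_comp measurable_fst (@measurable_coord R t)). Qed.

Let minitial : measurable [set om : traj R | (om 0%N).1 = x].
Proof.
apply: (measurable_preimageT (mstate 0) (B := [set x])).
rewrite (_ : [set x] = [set x.1] `*` [set x.2]).
  by apply: measurableX; exact: measurable_set1.
by apply/seteqP; split => [s ->//|[s1 s2] [/= -> ->]]; case: x.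
Qed.

Lemma integral_initial (g : st R -> \bar R) : measurable_fun setT g ->
  \int[P]_om g (om 0%N).1 = g x.
Proof.
move=> mg; transitivity (\int[P]_om g x); last exact: integral_prob_cst.
apply: ae_eq_integral => //.
- exact: (measurableT_comp mg (mstate 0)).
- by have [h0 _ _] := HP; apply: ae_prob1 minitial h0 _ => om /= -> _.
Qed.

Let marginal t (A : set (st R)) : measurable A ->
  P [set om | A (om t.+1).1] = \int[P]_om trans a p01 p11 (om t).1 (om t).2 A.
Proof.
move=> mA; have [_ _ /(_ t setT A measurableT mA)] := HP.
rewrite (_ : [set om : traj R | setT (past t.+1 om)] = setT);
  last by apply/seteqP; split.
by move=> <-; congr (P _); apply/seteqP; split => [om //|om []].
Qed.

(** For an arbitrary path law this must come from the transition clause: the induction hypothesis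
    allows replacing [trans] by [sample], which always lands in [st_space]. *)
Lemma law_st_space t : P [set om | st_space (om t).1] = 1.
Proof.
elim: t => [|t ih].
  have [h0 _ _] := HP.
  have mS := @measurable_st_space_at R 0.
  apply/eqP; rewrite eq_le; apply/andP; split; first exact: probability_le1.
  apply: (@le_trans _ _ (P [set om : traj R | (om 0%N).1 = x]));
    first by rewrite h0.
  by apply: le_measure; rewrite ?inE => // om /= ->.
apply: (etrans (marginal t (@measurable_st_space R))).
rewrite (@integral_trans R a p01 p11 P t setT _ measurableT
  (@measurable_st_space R) ih).
transitivity (\int[P]_om (1 : \bar R)); last exact: integral_prob_cst.
apply: eq_integral => om _; rewrite (_ : _ @^-1` _ = setT);
  first exact: probability_setT.
by apply/seteqP; split => // v _; exact: sample_st_space.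
Qed.

(** Extends the transition clause from sets to functions: the law of the state at [t.+1] is the
    image of the product of [P] and [unif] under one sampling step, and Tonelli applies. *)
Lemma law_integral t (g : st R -> \bar R) : measurable_fun setT g ->
  (forall s, 0 <= g s) ->
  \int[P]_om g (om t.+1).1 = \int[P]_om next_mean g (om t).1 (om t).2.
Proof.
move=> mg g0.
have ms := measurable_sample_next a p01 p11 t.
pose m1 := image_measure P (mstate t.+1).
pose m2 := image_measure (P \x unif) ms.
have m12 (A : set (st R)) : measurable A -> m1 A = m2 A.
  move=> mA; rewrite !image_measureE -(integral_indic_comp _ ms mA).
  rewrite fubini_tonelli1; last 2 first.
  - apply/measurable_EFinP.
    have mi : measurable_fun [set: st R] (\1_A : st R -> TR) by
      exact: measurable_indic.
    exact: (measurableT_comp mi ms).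
  - by move=> z; rewrite lee_fin indicE.
  apply: (etrans (marginal t mA)).
  rewrite (@integral_trans R a p01 p11 P t setT _ measurableT mA
    (law_st_space t)).
  apply: eq_integral => om _.
  by rewrite /fubini_F/= (integral_indic_comp unif
    (@measurable_sample_at _ a p01 p11 _ _) mA).
transitivity (\int[m1]_s g s).
  exact: (esym (ge0_integral_pushforward (mstate t.+1) P measurableT mg
    (fun _ _ => g0 _))).
rewrite (eq_measure_integral m2); last by move=> A mA _; exact: m12.
transitivity (\int[P \x unif]_z g (sample (z.1 t).1 (z.1 t).2 z.2)).
  exact: (ge0_integral_pushforward ms _ measurableT mg (fun _ _ => g0 _)).
rewrite (fubini_tonelli1 (fun z : traj R * TR => g
  (sample (z.1 t).1 (z.1 t).2 z.2)))//.
exact: (measurableT_comp mg ms).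
Qed.

Let C t : \bar R := \int[P]_om stage (om t).1 (om t).2.

Let mstage t : measurable_fun [set: traj R] (fun om : traj R => stage (om t).1
  (om t).2).
Proof. exact: (measurableT_comp (measurable_stage lam)
  (@measurable_coord R t)). Qed.

Let C0 t : 0 <= C t.
Proof. by apply: integral_ge0 => om _; exact: stage_ge0. Qed.

Lemma integral_bellman t (g : st R -> \bar R) : measurable_fun setT g ->
  (forall s, 0 <= g s) ->
  \int[P]_om bellman g (om t).1 (om t).2 = C t + beta%:E * \int[P]_om g
    (om t.+1).1.
Proof.
move=> mg g0; have b0 : (0 <= beta)%R by case/andP: hbeta => /ltW.
have mK : measurable_fun [set: traj R] (fun om : traj R => next_mean g (om t).1
  (om t).2).
  exact: (measurableT_comp (measurable_next_mean a p01 p11 mg g0)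
    (@measurable_coord R t)).
rewrite ge0_integralD//; first last.
- exact: measurable_funeM.
- by move=> om _; apply: mule_ge0; [rewrite lee_fin|exact: next_mean_ge0].
- by move=> om _; exact: stage_ge0.
rewrite ge0_integralZl_EFin//; last by move=> om _; exact: next_mean_ge0.
by rewrite law_integral.
Qed.

(** Expected cost of [n] steps discounted from time [t] on. The free starting time lets inductions
    on [n] peel off the first step. *)
Let S n t : \bar R := \sum_(0 <= i < n) (beta ^+ i)%:E * C (t + i)%N.

Let SS n t : S n.+1 t = C t + beta%:E * S n t.+1.
Proof.
rewrite /S big_nat_recl// expr0 mul1e addn0; congr (_ + _).
rewrite ge0_sume_distrr; last by move=> i _;
  rewrite mule_ge0// lee_fin exprn_ge0//; case/andP: hbeta => /ltW.
by apply: eq_bigr => i _; rewrite muleA -EFinM -exprS addnS addSn.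
Qed.

(** The minimum is at most the value at the action actually taken, however that action depends on
    the history; integrating gives one stage cost plus the discounted next state. *)
Lemma value_iterc_le_cost n t : \int[P]_om W n (om t).1 <= S n t.
Proof.
have b0 : (0 <= beta)%R by case/andP: hbeta => /ltW.
elim: n t => [|n ih] t.
  by rewrite /S big_nil; under eq_integral do rewrite /=; rewrite integral0.
have mW : measurable_fun [set: st R] (W n) by exact: measurable_value_iterc.
have mW1 : measurable_fun [set: st R] (W n.+1) by exact: measurable_value_iterc.
have W0 s : 0 <= W n s by exact: value_iterc_ge0.
have b0E : 0 <= beta%:E by rewrite lee_fin.
rewrite SS; apply: (le_trans _ (leeD2l (C t) (lee_wpmul2l b0E (ih t.+1)))).
rewrite -integral_bellman//; apply: ge0_le_integral => //.
- by move=> om _; exact: value_iterc_ge0.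
- exact: (measurableT_comp mW1 (mstate t)).
- exact: (measurableT_comp (measurable_bellman a lam beta p01 p11 mW W0)
    (@measurable_coord R t)).
- move=> om _; change (mine (bellman (W n) (om t).1 false)
    (bellman (W n) (om t).1 true) <=
    bellman (W n) (om t).1 (om t).2).
  exact: mine_le_bool (bellman (W n) (om t).1) (om t).2.
Qed.

(* Along a law whose actions attain the minimum, the optimality equation
   telescopes. *)
Lemma cost_le_value_lim n t :
  (forall i, {ae P, forall om, V (om i).1 = bellman V (om i).1 (om i).2}) ->
  S n t <= \int[P]_om V (om t).1.
Proof.
move=> hV; have b0 : (0 <= beta)%R by case/andP: hbeta => /ltW.
have mV : measurable_fun [set: st R] V by exact: measurable_value_lim.
have V0 s : 0 <= V s by exact: value_lim_ge0.
have b0E : 0 <= beta%:E by rewrite lee_fin.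
(* The base case drops the terminal value left over by the telescoping, which is nonnegative. *)
elim: n t => [|n ih] t; first by rewrite /S big_nil; apply: integral_ge0.
rewrite SS; apply: (le_trans (leeD2l (C t) (lee_wpmul2l b0E (ih t.+1)))).
rewrite -integral_bellman// le_eqVlt; apply/orP; left; apply/eqP/esym.
apply: ae_eq_integral => //.
- exact: (measurableT_comp mV (mstate t)).
- exact: (measurableT_comp (measurable_bellman a lam beta p01 p11 mV V0)
    (@measurable_coord R t)).
- case: (hV t) => N [mN N0 hN]; exists N; split=> // om hom.
  by apply: hN => /= h; apply: hom => _; exact: h.
Qed.

Let costE : \int[P]_om total_cost lam beta om = \sum_(0 <= t <oo)
  (beta ^+ t)%:E * C t.
Proof.
have b0 : (0 <= beta)%R by case/andP: hbeta => /ltW.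
rewrite /total_cost integral_nneseries//.
- apply: eq_eseriesr => t _; rewrite /C -ge0_integralZl_EFin//.
  + by move=> om _; exact: stage_ge0.
  + exact: exprn_ge0.
- by move=> t; exact: (measurable_funeM (beta ^+ t)%:E (mstage t)).
- move=> t om _; rewrite EFinM; apply: mule_ge0; last exact: stage_ge0.
  by rewrite lee_fin exprn_ge0.
Qed.

Let term_ge0 t : 0 <= (beta ^+ t)%:E * C t.
Proof. by apply: mule_ge0 => //; rewrite lee_fin exprn_ge0//;
  case/andP: hbeta => /ltW. Qed.

Lemma value_lim_le_cost : V x <= \int[P]_om total_cost lam beta om.
Proof.
apply: lime_le; first exact: cvg_value_iterc.
apply: nearW => n.
have mW : measurable_fun [set: st R] (W n) by exact: measurable_value_iterc.
rewrite costE -(integral_initial mW);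
  apply: le_trans (value_iterc_le_cost n 0) _.
exact: nneseries_lim_ge.
Qed.

Lemma optimal_cost_le :
  (forall i, {ae P, forall om, V (om i).1 = bellman V (om i).1 (om i).2}) ->
  \int[P]_om total_cost lam beta om <= V x.
Proof.
move=> hV; have mV : measurable_fun [set: st R] V by
  exact: measurable_value_lim.
rewrite costE; apply: lime_le; first exact: is_cvg_nneseries.
apply: nearW => n; rewrite -(integral_initial mV).
exact: (cost_le_value_lim n 0 hV).
Qed.

End law_properties.

(** * The greedy policy and the identification of the value *)

Section optimal_policy.
Variables (R : realType) (a lam beta p01 p11 : R).
Hypotheses (hlam : 0 <= lam) (hbeta : 0 < beta < 1)
  (hp01 : 0 <= p01 <= 1) (hp11 : 0 <= p11 <= 1).
Local Notation E := (st R * bool)%type.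
Local Notation V := (value_lim a lam beta p01 p11).
Local Notation bellman := (bellman a lam beta p01 p11).
Local Open Scope ereal_scope.

(** The strict comparison resolves ties in favour of not transmitting. *)
Definition greedy (s : st R) : bool := bellman V s true < bellman V s false.

Lemma bellman_greedy s : bellman V s (greedy s) = mine (bellman V s false)
  (bellman V s true).
Proof.
by rewrite /greedy; case: ltP.
Qed.

Lemma measurable_greedy : measurable_fun [set: st R] greedy.
Proof.
have mV : measurable_fun [set: st R] V by exact: measurable_value_lim.
have V0 s : 0 <= V s by exact: value_lim_ge0.
have mb u : measurable_fun [set: st R] (fun s => bellman V s u).
  exact: (measurableT_comp (measurable_bellman a lam beta p01 p11 mV V0)
    (pair2_measurable u)).
apply: (measurable_fun_bool true).
rewrite setTI.
rewrite (_ : _ @^-1` _ = [set: st R] `&` [set s | bellman V s true < bellman V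
  s false]).
  exact: measurable_lte.
by rewrite setTI; apply/seteqP; split.
Qed.

Definition greedy_mfun : {mfun st R >-> bool} :=
  HB.pack greedy (isMeasurableFun.Build _ _ _ _ greedy measurable_greedy).

Definition greedy_policy : policy R := fun t =>
  HB.pack (fun z : t.-tuple E * st R => greedy z.2)
    (isMeasurableFun.Build _ _ _ _ (fun z : t.-tuple E * st R => greedy z.2)
       (measurableT_comp measurable_greedy measurable_snd)).

Lemma path_lawP phi x : st_space x ->
  is_path_law a p01 p11 phi x (path_law a p01 p11 phi x).
Proof. by move=> sx; apply: getPex; exact: path_law_exists. Qed.

Lemma value_lim_le_policy_value phi x : st_space x ->
  V x <= policy_value a lam beta p01 p11 phi x.
Proof. by move=> sx; apply: value_lim_le_cost (path_lawP phi sx). Qed.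

Lemma greedy_policy_value_le x : st_space x ->
  policy_value a lam beta p01 p11 greedy_policy x <= V x.
Proof.
move=> sx; have HP := path_lawP greedy_policy sx.
apply: optimal_cost_le (HP) _ => // i.
have [_ /(_ i) h1 _] := HP.
apply: ae_prob1 h1 _ => [|om /= ->]; last first.
  by rewrite bellman_greedy; exact: value_lim_bellman.
have mu : measurable_fun [set: traj R] (fun om : traj R => (om i).2).
  exact: (measurableT_comp measurable_snd (@measurable_coord R i)).
have mg : measurable_fun [set: traj R] (fun om : traj R => greedy (om i).1).
  apply: (measurableT_comp measurable_greedy).
  exact: (measurableT_comp measurable_fst (@measurable_coord R i)).
(* Equality of two measurable booleans is split over their common value to obtain a measurable
   event. *)
rewrite (_ : [set om | _] = (fun om : traj R => (om i).2) @^-1` [set true] `&`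
    (fun om : traj R => greedy (om i).1) @^-1` [set true] `|`
    (fun om : traj R => (om i).2) @^-1` [set false] `&`
    (fun om : traj R => greedy (om i).1) @^-1` [set false]).
  by apply: measurableU; apply: measurableI; exact: measurable_preimageT.
apply/seteqP; split => om /=.
  by move=> ->; case: (greedy _); [left|right].
by case=> -[-> ->].
Qed.

Lemma opt_valueE x : st_space x -> opt_value a lam beta p01 p11 x = V x.
Proof.
move=> sx; apply/eqP; rewrite eq_le; apply/andP; split.
  apply: le_trans (greedy_policy_value_le sx).
  by apply: ereal_inf_lbound; exists greedy_policy.
by apply: le_ereal_inf_tmp => _ [phi _ <-]; exact: value_lim_le_policy_value.
Qed.

Lemma greedy_policy_optimal : optimal a lam beta p01 p11 greedy_policy.
Proof.
move=> x sx; apply/eqP; rewrite eq_le; apply/andP; split.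
  by rewrite opt_valueE//; exact: greedy_policy_value_le.
by apply: ereal_inf_lbound; exists greedy_policy.
Qed.

Lemma Qfun_opt_value s u : st_space s ->
  Qfun a lam beta p01 p11 (opt_value a lam beta p01 p11) s u = bellman V s u.
Proof.
move=> ss; rewrite (eq_Qfun _ _ _ hp01 hp11 u opt_valueE ss).
apply: QfunE => //; first exact: measurable_value_lim.
exact: value_lim_ge0.
Qed.

End optimal_policy.

Theorem mainTheorem2 (R : realType) (a lam beta p01 p11 : R)
    (hlam : 0 <= lam) (hbeta : 0 < beta < 1)
    (hp01 : 0 < p01 <= 1) (hp11 : 0 < p11 <= 1)
    (ha : a ^+ 2 * (1 - p01) < 1) :
  (* (a) *)
  (forall (e b : R), 0 <= b <= 1 ->
     opt_value a lam beta p01 p11 (e, b) \is a fin_num /\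
     value_iter a lam beta p01 p11 n (e, b) @[n --> \oo] -->
       opt_value a lam beta p01 p11 (e, b)) /\
  (* (b) *)
  (forall (e b : R), 0 <= b <= 1 ->
     opt_value a lam beta p01 p11 (e, b) =
     mine (Qfun a lam beta p01 p11 (opt_value a lam beta p01 p11) (e, b) false)
          (Qfun a lam beta p01 p11 (opt_value a lam beta p01 p11) (e, b) true)) /\
  (* (c) *)
  (exists (phi : policy R) (f : {mfun st R >-> bool}),
     [/\ stationary phi f,
         optimal a lam beta p01 p11 phi &
         forall (e b : R), 0 <= b <= 1 ->
           Qfun a lam beta p01 p11 (opt_value a lam beta p01 p11)
             (e, b) (f (e, b)) =
           mine (Qfun a lam beta p01 p11 (opt_value a lam beta p01 p11)
                   (e, b) false)
                (Qfun a lam beta p01 p11 (opt_value a lam beta p01 p11)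
                   (e, b) true)]).
Proof.
have h01 : 0 <= p01 <= 1 by case/andP: hp01 => /ltW -> ->.
have h11 : 0 <= p11 <= 1 by case/andP: hp11 => /ltW -> ->.
split; [|split].
- move=> e b sb; rewrite opt_valueE//; split.
    exact: value_lim_fin_num.
  under eq_fun do rewrite value_iterE//.
  exact: cvg_value_iterc.
- move=> e b sb; rewrite opt_valueE// !Qfun_opt_value//;
    exact: value_lim_bellman.
- exists (greedy_policy a hlam hbeta h01 h11),
    (greedy_mfun a hlam hbeta h01 h11).
  split; [by []|exact: greedy_policy_optimal|].
  move=> e b sb; rewrite !Qfun_opt_value//; exact: bellman_greedy.
Qed.
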